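(* For $n\ge 4$ and $k=1,\ldots,n-3$, $$\beta(\mathbb{R}_+^{n,(k)})=1,\qquad \beta(\mathcal{S}_+^{n,(k)})=\frac{n^2-n+2}{2}.$$
   Context: For a closed convex cone $K$ in a finite-dimensional real vector space $V$, $\operatorname{Aut}(K)$ is the group of bijective linear maps $A:V\to V$ with $AK=K$. The Lyapunov rank $\beta(K)$ of a pointed full-dimensional closed convex cone $K$ is the dimension of the Lie algebra of the Lie group $\operatorname{Aut}(K)$ (equivalently, the dimension of $\operatorname{Aut}(K)$ as a smooth manifold). For a homogeneous polynomial $g$ on $V$ that is hyperbolic along $e$ (i.e. $g(e)>0$ and $t\mapsto g(x-te)$ has only real roots for every $x$), $\Lambda_+(g,e)=\{x\in V\mid\text{all roots of }t\mapsto g(te-x)\text{ are nonnegative}\}$, and $D_e^kg(x)=\frac{d^k}{dt^k}g(x+te)|_{t=0}$. $\mathbb{R}_+^{n,(k)}=\Lambda_+(D_e^kp,e)$ with $p(x)=x_1\cdots x_n$ on $\mathbb{R}^n$ and $e=(1,\ldots,1)^T$; equivalently, $\mathbb{R}_+^{n,(k)}=\{x\in\mathbb{R}^n\mid s_i(x)\ge 0,\ i=1,\ldots,n-k\}$ with $s_i$ the elementary symmetric polynomial of degree $i$. $\mathcal{S}_+^{n,(k)}=\Lambda_+(D_{I_n}^k\det,I_n)$ on the space $\mathcal{S}^n$ of $n\times n$ real symmetric matrices, with $I_n$ the identity matrix; equivalently, it is the set of $X\in\mathcal{S}^n$ whose vector of eigenvalues lies in $\mathbb{R}_+^{n,(k)}$.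 *)

(* Defs.v *)
From mathcomp Require Import all_boot all_order all_algebra.
From mathcomp Require Import all_classical all_reals all_analysis.

Set Implicit Arguments.
Unset Strict Implicit.
Unset Printing Implicit Defensive.

Import Order.TTheory GRing.Theory Num.Theory.
Import numFieldNormedType.Exports passmx.

Local Open Scope classical_set_scope.
Local Open Scope ring_scope.

Section LyapunovRank.
Variables (R : realType) (V : vectType R).

Definition mxexp (m : nat) (A : 'M[R]_m) : 'M[R]_m :=
  limn (series (fun j : nat => j`!%:R^-1 *: A ^+ j)).

(* The result does not depend on the basis: every matrix power is computed in
   the same basis, and conjugation by a change of basis is continuous. *)
Definition lfun_exp (f : 'End(V)) : 'End(V) :=
  let b := vbasis {:V}%VS in hommx b b (mxexp (mxof b b f)).

Definition Aut_cone (K : set V) : set 'End(V) :=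
  [set f | bijective f /\ f @` K = K].

(* The Lie algebra of a closed subgroup G of GL(V) is
   { f | exp (t f) belongs to G for all real t }. *)
Definition lie_Aut_cone (K : set V) : set 'End(V) :=
  [set f | forall t : R, Aut_cone K (lfun_exp (t *: f))].

(* For a proper cone K, Aut_cone K is closed in GL(V), so lie_Aut_cone K is a
   linear subspace and xget returns it; otherwise the value may be the default
   \dim 0 = 0. *)
Definition lyapunov_rank (K : set V) : nat :=
  \dim (xget 0%VS [set U : {vspace 'End(V)} | [set` U] = lie_Aut_cone K]).

End LyapunovRank.

Section Hyperbolicity.
Variables (R : realType) (V : vectType R).

Definition Ddir (k : nat) (e : V) (g : V -> R) (x : V) : R :=
  derive1n k (fun t : R => g (x + t *: e)) 0.

(* Only real roots are tested: g is meant to be hyperbolic along e, so that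
   t |-> g (t e - x) has no other roots. *)
Definition hyp_cone (g : V -> R) (e : V) : set V :=
  [set x | forall t : R, g (t *: e - x) = 0 -> 0 <= t].

End Hyperbolicity.

Definition orthant_relax (R : realType) (n k : nat) : set 'cV[R]_n :=
  let e : 'cV[R]_n := const_mx 1 in
  hyp_cone (Ddir k e (fun x => \prod_(i < n) x i 0)) e.

Definition sym_space (R : realType) (n : nat) : {vspace 'M[R]_n} :=
  fixedSpace (linfun (trmx : 'M[R]_n -> 'M[R]_n)).

Lemma sym_spaceP (R : realType) (n : nat) (A : 'M[R]_n) :
  reflect (A^T = A) (A \in sym_space R n).
Proof. by apply: (iffP fixedSpaceP); rewrite lfunE. Qed.

Lemma sym_space1 (R : realType) (n : nat) : 1%:M \in sym_space R n.
Proof. by apply/sym_spaceP; rewrite trmx1. Qed.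

Definition psd_relax (R : realType) (n k : nat) :
    set (subvs_of (sym_space R n)) :=
  let e : subvs_of (sym_space R n) := Subvs (sym_space1 R n) in
  hyp_cone (Ddir k e (fun X => \det (vsval X))) e.

Arguments orthant_relax R n k : clear implicits.
Arguments psd_relax R n k : clear implicits.

(* Main.v *)
Require Import Defs.
From HB Require Import structures.
From mathcomp Require Import all_boot all_order all_algebra.
From mathcomp Require Import all_classical all_reals all_analysis.
From mathcomp Require Import perm polyrcf cauchyreals zify lra.

Set Implicit Arguments.
Unset Strict Implicit.
Unset Printing Implicit Defensive.

Import Order.TTheory GRing.Theory Num.Theory.
Import numFieldNormedType.Exports passmx.

Local Open Scope classical_set_scope.
Local Open Scope ring_scope.

(** Why the theorem holds. For a vector x or a symmetric matrix X, let P
    be the polynomial prod_i (s + x_i), resp. det (s + X), in the variable s.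
    Up to a change of the sign of s, the polynomial tested by the k-th
    derivative cone is the k-th derivative of P, so the cone is the set of
    points for which this derivative has no positive root [hyp_cone_derivP].
    Such a P has a nonnegative k-th coefficient, which up to the factor k! is
    the value at the point of the k-th directional derivative defining the
    cone.

    Let f belong to the Lie algebra, and let x be a point of the cone at which
    the k-th coefficient of P vanishes. The curve exp (t f) x stays in the
    cone for all real t, so the k-th coefficient along it has a minimum at t =
    0 and its derivative there vanishes [coef_pderive_eq0]: the velocity f x
    is tangent to the hypersurface where the coefficient is zero. Two kinds of
    points x are enough. Vectors with exactly k + 1 zero entries and all
    others positive force the off-diagonal entries of the matrix of f to
    vanish [tangent_mx_offdiag], and the vectors with n - 1 entries 1 and one
    entry - k / (n - k) force the diagonal entries to be equal
    [tangent_mx_diag]. Hence the Lie algebra of the cone of vectors is the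
    line of homotheties, which gives the rank 1.

    For symmetric matrices the same argument applies in every orthonormal
    frame u_1, ..., u_n, to the matrix with entries u_i^T f(u_j u_j^T) u_i: it
    is a scalar matrix, with the same scalar c for all frames
    [frame_mx_scalar]. So g = f - c satisfies u^T g(u u^T) u = 0 for all u,
    and v^T g(u u^T) v = 0 whenever u and v are orthogonal. Polarizing these
    identities shows that g is X |-> A X - X A with A skew-symmetric
    [commutator_of_sq_vanishing].

    Conversely, along X' = A X - X A the polynomial det (s + X) is constant,
    by Jacobi's formula [shift_det_lax], and the term c X only rescales X. So
    the Lie algebra consists of the maps X |-> c X + A X - X A, with c real
    and A skew-symmetric, and its dimension is 1 + n (n - 1) / 2 [dim_co_end].

    The exponential enters only through three facts: the curve exp (t f) v has
    velocity f (exp (t f) v), it starts at v, and exp (- t f) inverts exp (t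
    f). *)

(** * Derivatives of finite sums and products of real functions *)

Section RealCurves.
Variable R : realType.
Implicit Types (f g : R -> R) (t : R).

Lemma is_derive_sumf (I : Type) (r : seq I) (P : pred I) (F : I -> R -> R)
    (D : I -> R) t :
  (forall i, P i -> is_derive t (1 : R) (F i) (D i)) ->
  is_derive t (1 : R) (fun s => \sum_(i <- r | P i) F i s)
    (\sum_(i <- r | P i) D i).
Proof.
move=> h; rewrite (_ : (fun s => _) = \sum_(i <- r | P i) F i); last first.
  by apply/funext => s; rewrite fct_sumE.
apply: (big_ind2 (fun f d => is_derive t (1 : R) f d)) => //.
  exact: is_derive_cst.
by move=> *; exact: is_deriveD.
Qed.

Lemma is_deriveMf f g t df dg :
  is_derive t (1 : R) f df -> is_derive t (1 : R) g dg ->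
  is_derive t (1 : R) (fun s => f s * g s) (df * g t + f t * dg).
Proof.
move=> hf hg; have := is_deriveM hf hg.
by rewrite /GRing.scale/= addrC [g t * _]mulrC.
Qed.

Lemma is_deriveMl (c : R) f t df :
  is_derive t (1 : R) f df -> is_derive t (1 : R) (fun s => c * f s) (c * df).
Proof. exact: is_deriveZ. Qed.

Lemma is_deriveMr (c : R) f t df :
  is_derive t (1 : R) f df -> is_derive t (1 : R) (fun s => f s * c) (df * c).
Proof.
by move=> /(is_deriveMl c); rewrite mulrC; under eq_fun do rewrite mulrC.
Qed.

Lemma is_derive_oppf f t df :
  is_derive (- t) (1 : R) f df -> is_derive t (1 : R) (fun s => f (- s)) (- df).
Proof.
move=> h; have := @is_derive1_comp _ f -%R t df (- 1) h (is_deriveNid _ _).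
by rewrite mulrN1.
Qed.

Lemma cvgn_sum (I : Type) (r : seq I) (u : I -> nat -> R) (a : I -> R) :
  (forall i, u i n @[n --> \oo] --> a i) ->
  \sum_(i <- r) u i n @[n --> \oo] --> \sum_(i <- r) a i.
Proof.
move=> h; apply: (@cvg_big _ _ _ _ predT) => //.
exact: add_continuous.
Qed.

End RealCurves.

(** * The matrix exponential and its derivative *)

Section MatrixExponential.
Variables (R : realType) (m : nat).
Implicit Types A : 'M[R]_m.

(** The sum of the absolute values of all entries is submultiplicative and
    bounds every entry, so the exponential series is dominated entrywise by
    a scalar one. *)
Lemma normr_mx_exp_le A : exists2 B : R, 0 <= B &
  forall j i k, `|(A ^+ j) i k| <= B ^+ j.
Proof.
pose B := \sum_i \sum_l `|A i l|.
have B0 : 0 <= B by apply: sumr_ge0 => i _; apply: sumr_ge0.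
exists B => //; elim=> [|j IH] i k.
  by rewrite !expr0 mxE; case: eqP; rewrite ?normr1 ?normr0.
rewrite exprS mxE (le_trans (ler_norm_sum _ _ _))// exprS.
apply: (@le_trans _ _ ((\sum_l `|A i l|) * B ^+ j)).
  by rewrite mulr_suml; apply: ler_sum => l _; rewrite normrM ler_wpM2l.
rewrite ler_wpM2r ?exprn_ge0// /B [leRHS](bigD1 i)//= lerDl.
by apply: sumr_ge0 => a _; apply: sumr_ge0.
Qed.

Definition exp_entry A i k (j : nat) : R := j`!%:R^-1 * (A ^+ j) i k.

Lemma is_cvg_exp_entry A i k (x : R) : cvgn (pseries (exp_entry A i k) x).
Proof.
have [B B0 hB] := normr_mx_exp_le A.
apply: normed_cvg; rewrite /normed_series_of /=.
apply: (series_le_cvg _ _ _ (is_cvg_series_exp_coeff (B * `|x|))) => [j|j|j] //.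
  by rewrite exp_coeff_ge0// mulr_ge0.
rewrite /exp_entry !normrM /= /exp_coeff /= ger0_norm ?invr_ge0//.
rewrite normrX exprMn mulrAC -[leRHS]mulrC -mulrA ler_wpM2l ?invr_ge0//.
by rewrite mulrC ler_wpM2r ?exprn_ge0.
Qed.

(** Topologically the series converges as a sequence of matrices; continuity
    of the coordinates then turns its limit into limits of real series. *)
Lemma mxexpE A i k : mxexp A i k = limn (series (exp_entry A i k)).
Proof.
pose S := series (fun j : nat => j`!%:R^-1 *: A ^+ j).
have SE a b : (fun N => S N a b) = series (exp_entry A a b).
  apply/funext => N; rewrite /S /series /= summxE.
  by apply: eq_bigr => j _; rewrite mxE.
have C a b : cvgn (series (exp_entry A a b)).
  have := @is_cvg_exp_entry A a b 1; rewrite /pseries.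
  by under eq_fun do rewrite expr1n mulr1.
have cS : cvgn S.
  apply/cvg_ex; exists (\matrix_(a, b) limn (series (exp_entry A a b))).
  apply/cvg_mx_entourageP => E entE.
  near=> N => a b; move: a b.
  near: N; apply: filter_forall => a; apply: filter_forall => b.
  have /cvg_app_entourageP := C a b => /(_ _ entE).
  by apply: filterS => N hN; apply/mem_set; rewrite mxE; move: hN; rewrite -SE.
rewrite /mxexp -/S -SE; apply/esym/cvg_lim => //.
exact: (continuous_cvg _ (@coord_continuous _ _ _ i k _) cS).
Unshelve. all: by end_near. Qed.


Lemma expmx_scale A (t : R) j : (t *: A) ^+ j = t ^+ j *: A ^+ j.
Proof.
elim: j => [|j IH]; first by rewrite !expr0 scale1r.
by rewrite !exprS IH -!mulmxE -scalemxAl -scalemxAr scalerA.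
Qed.

Lemma mxexp_scaleE A (t : R) i k :
  mxexp (t *: A) i k = limn (pseries (exp_entry A i k) t).
Proof.
rewrite mxexpE /pseries; congr (limn (series _)); apply/funext => j.
by rewrite /exp_entry expmx_scale mxE mulrCA mulrC.
Qed.

Lemma mxexp0 : mxexp (0 : 'M[R]_m) = 1%:M.
Proof.
apply/matrixP => i k; rewrite mxexpE; apply: cvg_lim => //.
rewrite -(cvg_shiftS _) /=.
under eq_fun => N.
  rewrite /series /= big_nat_recl// /exp_entry fact0 invr1 mul1r expr0.
  rewrite big1 ?addr0; last by move=> j _; rewrite expr0n/= mxE mulr0.
  over.
exact: cvg_cst.
Qed.

Lemma cvg_exp_entry A i k (t : R) :
  pseries (exp_entry A i k) t n @[n --> \oo] --> mxexp (t *: A) i k.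
Proof. by rewrite mxexp_scaleE; apply: is_cvg_exp_entry. Qed.

(** Differentiating t^j A^j / j! gives A times the previous term. Factoring
    A out on the left here, and on the right in the next lemma, also shows
    that A commutes with its exponential. *)
Lemma pseries_diffs_exp_entryl A i k : pseries_diffs (exp_entry A i k) =
  fun j => \sum_l A i l * exp_entry A l k j.
Proof.
apply/funext => j; rewrite /pseries_diffs /exp_entry factS natrM invfM.
rewrite -mulrA mulVKf ?pnatr_eq0// exprS mxE mulr_sumr.
by apply: eq_bigr => l _; rewrite mulrCA.
Qed.

Lemma pseries_diffs_exp_entryr A i k : pseries_diffs (exp_entry A i k) =
  fun j => \sum_l exp_entry A i l j * A l k.
Proof.
apply/funext => j; rewrite /pseries_diffs /exp_entry factS natrM invfM.
rewrite -mulrA mulVKf ?pnatr_eq0// exprSr mxE mulr_sumr.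
by apply: eq_bigr => l _; rewrite mulrA.
Qed.

Lemma cvg_diffs_exp_entryl A i k (t : R) :
  pseries (pseries_diffs (exp_entry A i k)) t n @[n --> \oo] -->
  (A *m mxexp (t *: A)) i k.
Proof.
rewrite pseries_diffs_exp_entryl mxE.
rewrite (_ : pseries _ t =
    fun N => \sum_l A i l * pseries (exp_entry A l k) t N); last first.
  apply/funext => N; rewrite /pseries /series /=.
  under [RHS]eq_bigr do rewrite mulr_sumr.
  rewrite exchange_big /=; apply: eq_bigr => j _.
  by rewrite mulr_suml; apply: eq_bigr => l _; rewrite mulrA.
by apply: cvgn_sum => l; apply: cvgMl_tmp; exact: cvg_exp_entry.
Qed.

Lemma cvg_diffs_exp_entryr A i k (t : R) :
  pseries (pseries_diffs (exp_entry A i k)) t n @[n --> \oo] -->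
  (mxexp (t *: A) *m A) i k.
Proof.
rewrite pseries_diffs_exp_entryr mxE.
rewrite (_ : pseries _ t =
    fun N => \sum_l pseries (exp_entry A i l) t N * A l k); last first.
  apply/funext => N; rewrite /pseries /series /=.
  under [RHS]eq_bigr do rewrite mulr_suml.
  rewrite exchange_big /=; apply: eq_bigr => j _.
  by rewrite mulr_suml; apply: eq_bigr => l _; rewrite mulrAC.
by apply: cvgn_sum => l; apply: cvgMr_tmp; exact: cvg_exp_entry.
Qed.

Lemma mxexp_comm A (t : R) : A *m mxexp (t *: A) = mxexp (t *: A) *m A.
Proof.
apply/matrixP => i k.
have /cvg_lim <- // := @cvg_diffs_exp_entryl A i k t.
by have /cvg_lim <- // := @cvg_diffs_exp_entryr A i k t.
Qed.

(** Each entry is a power series in t that converges everywhere, hence can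
    be differentiated term by term. *)
Lemma is_derive_mxexp A i k (t : R) :
  is_derive t (1 : R) (fun s => mxexp (s *: A) i k)
    ((A *m mxexp (t *: A)) i k).
Proof.
under eq_fun do rewrite mxexp_scaleE.
have /cvg_lim <- // := @cvg_diffs_exp_entryl A i k t.
pose K := `|t| + 1.
apply: (@pseries_snd_diffs _ _ K).
- exact: is_cvg_exp_entry.
- by apply/cvg_ex; exists ((A *m mxexp (K *: A)) i k);
    exact: cvg_diffs_exp_entryl.
- rewrite pseries_diffs_exp_entryl.
  rewrite (_ : pseries_diffs _ =
      fun j => \sum_l A i l * pseries_diffs (exp_entry A l k) j); last first.
    apply/funext => j; rewrite /pseries_diffs mulr_sumr.
    by apply: eq_bigr => l _; rewrite mulrCA.
  rewrite (_ : pseries _ K = fun N =>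
      \sum_l A i l * pseries (pseries_diffs (exp_entry A l k)) K N); last first.
    apply/funext => N; rewrite /pseries /series /=.
    under [RHS]eq_bigr do rewrite mulr_sumr.
    rewrite exchange_big /=; apply: eq_bigr => j _.
    by rewrite mulr_suml; apply: eq_bigr => l _; rewrite mulrA.
  apply/cvg_ex; exists (\sum_l A i l * (A *m mxexp (K *: A)) l k).
  by apply: cvgn_sum => l; apply: cvgMl_tmp; exact: cvg_diffs_exp_entryl.
- by rewrite [ltRHS]ger0_norm ?addr_ge0// ltrDl.
Qed.

(** The product exp (t A) exp (- t A) has derivative zero because A commutes
    with exp (t A); this avoids multiplying two series. *)
Lemma mxexpNK A (t : R) : mxexp (t *: A) *m mxexp (- t *: A) = 1%:M.
Proof.
apply/matrixP => i k.
pose h s := \sum_l mxexp (s *: A) i l * mxexp (- s *: A) l k.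
have dh s : is_derive s (1 : R) h 0.
  have -> : 0 = \sum_l ((A *m mxexp (s *: A)) i l * mxexp (- s *: A) l k +
      mxexp (s *: A) i l * - (A *m mxexp (- s *: A)) l k).
    have e : (A *m mxexp (s *: A)) *m mxexp (- s *: A) =
        mxexp (s *: A) *m (A *m mxexp (- s *: A)).
      by rewrite mxexp_comm mulmxA.
    move/matrixP/(_ i k): e; rewrite !mxE => e.
    rewrite big_split/= e -big_split/= big1// => l _.
    by rewrite mulrN subrr.
  apply: is_derive_sumf => l _; apply: is_deriveMf.
    exact: is_derive_mxexp.
  exact: (is_derive_oppf (is_derive_mxexp A l k (- s))).
have := is_derive_0_is_cst t 0 dh; rewrite /h oppr0 scale0r mxexp0 => e.
rewrite mxE e; under eq_bigr do rewrite !mxE.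
rewrite (bigD1 i)//= eqxx mul1r big1 ?addr0 ?mxE// => l /negPf li.
by rewrite eq_sym li mul0r.
Qed.

End MatrixExponential.

(** * The flow of an endomorphism *)

Section LinearFlow.
Variables (R : realType) (V : vectType R).
Implicit Types (f : 'End(V)) (v : V) (l : {linear V -> R^o}).

Lemma lfun_expE f v : lfun_exp f v =
  vecof (vbasis {:V}%VS) (rVof (vbasis {:V}%VS) v *m
    mxexp (mxof (vbasis {:V}%VS) (vbasis {:V}%VS) f)).
Proof. by rewrite /lfun_exp hommxE //; exact: vbasisP. Qed.

Lemma lfun_exp0 v : lfun_exp (0 : 'End(V)) v = v.
Proof. by rewrite lfun_expE linear0 mxexp0 mulmx1 rVofK//; exact: vbasisP. Qed.

Lemma lfun_expNK f (t : R) v : lfun_exp (- t *: f) (lfun_exp (t *: f) v) = v.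
Proof.
have b := vbasisP {:V}.
by rewrite !lfun_expE vecofK// !linearZ/= -mulmxA mxexpNK mulmx1 rVofK.
Qed.

(** The differential equation of the flow, tested against linear
    functionals: this needs no norm on V, only the coordinates in which the
    exponential is computed. *)
Lemma is_derive_lfun_exp f l v (t : R) :
  is_derive t (1 : R) (fun s => l (lfun_exp (s *: f) v))
    (l (f (lfun_exp (t *: f) v))).
Proof.
set e := vbasis {:V}%VS; have be : basis_of {:V} e := vbasisP _.
set M := mxof e e f; pose c := rVof e v.
have E s : l (lfun_exp (s *: f) v) =
    \sum_i \sum_k c 0 k * mxexp (s *: M) k i * l e`_i.
  rewrite lfun_expE linearZ/= /vecof linear_sum; apply: eq_bigr => i _.
  by rewrite linearZ/= mxE [LHS]mulr_suml.
under eq_fun do rewrite E.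
have -> : l (f (lfun_exp (t *: f) v)) =
    \sum_i \sum_k c 0 k * (M *m mxexp (t *: M)) k i * l e`_i.
  rewrite lfun_expE (hom_vecof e be) linearZ/= -/M -mulmxA -mxexp_comm.
  rewrite /vecof linear_sum; apply: eq_bigr => i _.
  by rewrite linearZ/= mxE [LHS]mulr_suml.
apply: is_derive_sumf => i _; apply: is_derive_sumf => k _.
by apply: is_deriveMr; apply: is_deriveMl; exact: is_derive_mxexp.
Qed.

End LinearFlow.

(** * Differentiable curves of polynomials and Jacobi's formula *)

Section PolynomialCurves.
Variable R : realType.
Implicit Types (P Q : R -> {poly R}) (t : R).

(** Differentiability is required coefficient by coefficient. Since
    coefficients of products are finite sums of products, no bound on the
    degree is involved. *)
Definition is_pderive t P (dP : {poly R}) :=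
  forall k, is_derive t (1 : R) (fun s => (P s)`_k) dP`_k.

Lemma is_pderive_cst (p : {poly R}) t : is_pderive t (fun=> p) 0.
Proof. by move=> k; rewrite coef0; exact: is_derive_cst. Qed.

Lemma is_pderiveC (f : R -> R) t df :
  is_derive t (1 : R) f df -> is_pderive t (fun s => (f s)%:P) df%:P.
Proof.
move=> hf k; under eq_fun do rewrite coefC; rewrite coefC.
by case: ifP => _ //; exact: is_derive_cst.
Qed.

Lemma is_pderiveD P Q t dP dQ : is_pderive t P dP -> is_pderive t Q dQ ->
  is_pderive t (fun s => P s + Q s) (dP + dQ).
Proof.
move=> hP hQ k; under eq_fun do rewrite coefD.
by rewrite coefD; apply: is_deriveD; [exact: hP|exact: hQ].
Qed.

Lemma is_pderiveM P Q t dP dQ : is_pderive t P dP -> is_pderive t Q dQ ->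
  is_pderive t (fun s => P s * Q s) (dP * Q t + P t * dQ).
Proof.
move=> hP hQ k; under eq_fun do rewrite coefM.
rewrite coefD !coefM -big_split/=.
by apply: is_derive_sumf => i _; apply: is_deriveMf; [exact: hP|exact: hQ].
Qed.

Lemma is_pderive_sum (I : Type) (r : seq I) (F : I -> R -> {poly R}) dF t :
  (forall i, is_pderive t (F i) (dF i)) ->
  is_pderive t (fun s => \sum_(i <- r) F i s) (\sum_(i <- r) dF i).
Proof.
move=> h k; under eq_fun do rewrite coef_sum.
by rewrite coef_sum; apply: is_derive_sumf => i _; exact: h.
Qed.

Lemma is_pderive_prod (I : eqType) (r : seq I) (F : I -> R -> {poly R}) dF t :
  uniq r -> (forall i, is_pderive t (F i) (dF i)) ->
  is_pderive t (fun s => \prod_(i <- r) F i s)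
    (\sum_(i <- r) \prod_(j <- r) (if j == i then dF j else F j t)).
Proof.
move=> + h; elim: r => [_|x r IH /= /andP[xr ur]].
  by rewrite big_nil; under eq_fun do rewrite big_nil; exact: is_pderive_cst.
under eq_fun do rewrite big_cons.
have -> : \sum_(i <- x :: r) \prod_(j <- x :: r)
      (if j == i then dF j else F j t) =
    dF x * \prod_(j <- r) F j t +
    F x t * \sum_(i <- r) \prod_(j <- r) (if j == i then dF j else F j t).
  rewrite big_cons big_cons eqxx; congr (_ * _ + _).
    apply: eq_big_seq => j jr; case: eqP => // jx.
    by rewrite -jx jr in xr.
  rewrite mulr_sumr; apply: eq_big_seq => i ir.
  rewrite big_cons; case: eqP => // xi.
  by rewrite xi ir in xr.
by apply: is_pderiveM => //; exact: IH.
Qed.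

(** Jacobi's formula: differentiating the Leibniz expansion replaces one row
    at a time, and expanding along the replaced row produces the adjugate. *)
Lemma is_pderive_det n (M : R -> 'M[{poly R}]_n) (dM : 'M[{poly R}]_n) t :
  (forall i j, is_pderive t (fun s => M s i j) (dM i j)) ->
  is_pderive t (fun s => \det (M s)) (\tr (\adj (M t) *m dM)).
Proof.
move=> h.
(* the matrix with row i differentiated *)
pose N i := \matrix_(a, b) (if a == i then dM a b else M t a b).
have -> : \tr (\adj (M t) *m dM) = \sum_i \det (N i).
  rewrite /mxtrace; under eq_bigr do rewrite mxE.
  rewrite exchange_big/=; apply: eq_bigr => i _.
  rewrite (expand_det_row _ i); apply: eq_bigr => j _.
  rewrite mulrC !mxE eqxx; congr (_ * _); rewrite /cofactor; congr (_ * \det _).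
  apply/matrixP => a b; rewrite !mxE.
  by rewrite eq_sym (negPf (neq_lift _ _)).
rewrite (_ : \sum_i _ = \sum_(s : 'S_n) (-1) ^+ s *
    \sum_i \prod_j (if j == i then dM j (s j) else M t j (s j))); last first.
  rewrite /determinant exchange_big/=; apply: eq_bigr => s _.
  rewrite mulr_sumr; apply: eq_bigr => i _; congr (_ * _).
  by apply: eq_bigr => j _; rewrite mxE.
rewrite /determinant; apply: is_pderive_sum => s.
rewrite -[_ ^+ s * _]add0r.
rewrite -[X in X + _](mul0r (\prod_i M t i (s i))).
apply: is_pderiveM; first exact: is_pderive_cst.
by apply: is_pderive_prod; [exact: index_enum_uniq|move=> i; exact: h].
Qed.

End PolynomialCurves.

(** * Derivative cones in terms of polynomials *)

Section RelaxedPolynomials.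
Variable R : realType.
Implicit Types (p : {poly R}) (P : R -> {poly R}).

Definition no_pos_root_derivn (k : nat) p :=
  forall s : R, 0 < s -> p^`(k).[s] != 0.

Lemma derive1n_horner p k : derive1n k (horner p) = horner p^`(k).
Proof.
elim: k => [|k IH]; first by rewrite derive1n0 derivn0.
by rewrite derive1nS IH derivnS derivE.
Qed.

Lemma derivn_comp_opp_shift p (t : R) k :
  (p \Po (- 'X - t%:P))^`(k) = (-1) ^+ k *: (p^`(k) \Po (- 'X - t%:P)).
Proof.
elim: k => [|k IH]; first by rewrite !derivn0 scale1r.
rewrite !derivnS IH derivZ deriv_comp derivB derivN derivX derivC subr0.
by rewrite exprSr -scalerA scaleN1r mulrN1.
Qed.

(** For g homogeneous of degree d, the hypothesis says that p.[s] is g (x +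
    s e), in the form in which the cone tests it; a root t of the test
    polynomial is then a root - t of p^`(k). *)
Lemma hyp_cone_derivP (V : vectType R) (k d : nat) (g : V -> R) (e x : V) p :
  (forall s : R, g (s *: e - x) = (-1) ^+ d * p.[- s]) ->
  hyp_cone (Ddir k e g) e x <-> no_pos_root_derivn k p.
Proof.
move=> gp.
have E t : Ddir k e g (t *: e - x) = (-1) ^+ d * (-1) ^+ k * p^`(k).[- t].
  rewrite /Ddir (_ : (fun s => _) =
      horner ((-1) ^+ d *: (p \Po (- 'X - t%:P)))).
    rewrite derive1n_horner derivnZ derivn_comp_opp_shift !hornerE.
    by rewrite horner_comp !hornerE oppr0 sub0r.
  apply/funext => s; rewrite addrAC -scalerDl gp !hornerE horner_comp !hornerE.
  by rewrite opprD addrC.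
split=> [h s s0|h t /eqP].
  apply/negP => /eqP ps; have := h (- s); rewrite E opprK ps mulr0.
  by move=> /(_ erefl); rewrite oppr_ge0 leNgt s0.
rewrite E -exprD mulf_eq0 signr_eq0 /= leNgt => /eqP pt.
apply/negP => t0; have := h (- t); rewrite oppr_gt0 pt eqxx.
by move=> /(_ t0).
Qed.

(** The k-th derivative is positive far to the right; a negative value at 0
    would give it a positive root. *)
Lemma no_pos_root_derivn_coef_ge0 k p : p \is monic -> (k < size p)%N ->
  no_pos_root_derivn k p -> 0 <= p`_k.
Proof.
move=> pm kp hp.
have h0 : p^`(k).[0] = p`_k * k`!%:R.
  by rewrite horner_coef0 coef_derivn addn0 ffactnn mulr_natr.
rewrite leNgt; apply/negP => pk.
have lc : 0 < lead_coef p^`(k).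
  rewrite lead_coefE size_derivn coef_derivn.
  have -> : (k + (size p - k).-1 = (size p).-1)%N by lia.
  rewrite -lead_coefE (monicP pm) pmulrn_rgt0// ffact_gt0; lia.
have [b bP] := poly_pinfty_gt_lc lc.
pose c := Num.max b 0.
have pc : 0 < p^`(k).[c].
  by apply: (lt_le_trans lc); apply: bP; rewrite le_max lexx.
have [||x] := @poly_ivtoo _ p^`(k) 0 c.
- by rewrite le_max lexx orbT.
- by rewrite pmulr_llt0// h0 pmulr_llt0// ltr0n fact_gt0.
- by rewrite in_itv/= => /andP[x0 _]; apply/negP; exact: hp.
Qed.

(** Along a curve staying in the cone the k-th coefficient is nonnegative,
    so where it vanishes it is minimal and its derivative vanishes too. *)
Lemma coef_pderive_eq0 k (P dP : R -> {poly R}) :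
  (forall t, is_pderive t P (dP t)) ->
  (forall t, P t \is monic) -> (forall t, k < size (P t))%N ->
  (forall t, no_pos_root_derivn k (P t)) -> (P 0)`_k = 0 -> (dP 0)`_k = 0.
Proof.
move=> hd hm hs hr P0.
have d0 : is_derive 0 (1 : R) (fun s => (P s)`_k) 0.
  apply: (@derive1_at_min _ _ (-1) 1) => [|t _||t _].
  - by lra.
  - by have [] := hd t k.
  - by rewrite in_itv/= ltrN10 ltr01.
  - by rewrite P0; exact: no_pos_root_derivn_coef_ge0.
have [_ <-] := hd 0 k; by case: d0.
Qed.

End RelaxedPolynomials.

(** * Matrices tangent to the boundary of the derivative cone *)

Section TangentMatrices.
Variables (R : realType) (n : nat).
Implicit Types (x y : 'I_n -> R) (M : 'M[R]_n) (T : {set 'I_n}).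

Definition root_poly x : {poly R} := \prod_i ('X + (x i)%:P).

Definition root_polyD1 x i : {poly R} := \prod_(l | l != i) ('X + (x l)%:P).

Lemma size_root_poly x : size (root_poly x) = n.+1.
Proof.
have -> : root_poly x = \prod_i ('X - (- x i)%:P).
  by apply: eq_bigr => i _; rewrite polyCN opprK.
by rewrite size_prod_XsubC [index_enum _]unlock -enumT size_enum_ord.
Qed.

Lemma monic_root_poly x : root_poly x \is monic.
Proof.
have -> : root_poly x = \prod_i ('X - (- x i)%:P).
  by apply: eq_bigr => i _; rewrite polyCN opprK.
exact: monic_prod_XsubC.
Qed.

(** The velocity M x at a point x of the cone with vanishing k-th
    coefficient is tangent to the zero set of that coefficient, whose i-th
    partial derivative is the k-th coefficient of the product with the i-th
    factor left out. *)
Definition tangent_mx k M := forall x,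
  no_pos_root_derivn k (root_poly x) -> (root_poly x)`_k = 0 ->
  \sum_i (\sum_j M i j * x j) * (root_polyD1 x i)`_k = 0.

Lemma no_pos_root_derivn_coefs k (p : {poly R}) :
  p \is monic -> (k < size p)%N -> (forall i, (k <= i)%N -> 0 <= p`_i) ->
  no_pos_root_derivn k p.
Proof.
move=> pm kp hp s s0; rewrite horner_coef size_derivn.
have -> : (size p - k)%N = (size p - k).-1.+1 by lia.
rewrite big_ord_recr/= gt_eqF// ltr_wpDl//.
  apply: sumr_ge0 => i _; rewrite mulr_ge0 ?exprn_ge0 ?(ltW s0)//.
  by rewrite coef_derivn mulrn_wge0// hp// leq_addr.
rewrite mulr_gt0 ?exprn_gt0// coef_derivn.
have -> : (k + (size p - k).-1 = (size p).-1)%N by lia.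
rewrite -lead_coefE (monicP pm) pmulrn_rgt0// ffact_gt0; lia.
Qed.

(** At a point vanishing exactly on T, with k + 1 = #|T|, the polynomial is
    divisible by 'X^(k+1), so the point is on the boundary; only the partial
    derivatives in the directions of T survive there, and they are all
    equal. *)
Lemma tangent_mx_zeros k M T y : tangent_mx k M -> #|T| = k.+1 ->
  (forall i, 0 < y i) -> \sum_(j in ~: T) (\sum_(i in T) M i j) * y j = 0.
Proof.
move=> hM cT y0.
pose x i := if i \in T then 0 else y i.
pose q : {poly R} := \prod_(i in ~: T) ('X + (y i)%:P).
have E : root_poly x = q * 'X^(k.+1).
  rewrite /root_poly (bigID (mem T))/= mulrC; congr (_ * _).
    apply: eq_big => i; first by rewrite inE.
    by rewrite /x => /negPf ->.
  rewrite -cT -prodr_const; apply: eq_bigr => i iT.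
  by rewrite /x iT addr0.
have ED i : i \in T -> root_polyD1 x i = q * 'X^k.
  move=> iT; rewrite /root_polyD1 (bigID (mem T))/= mulrC; congr (_ * _).
    apply: eq_big => l; first by rewrite inE; case: eqP => // ->; rewrite iT.
    by rewrite /x => /andP[_ /negPf ->].
  have -> : k = #|T :\ i| by apply/eqP; rewrite -eqSS -cT (cardsD1 i) iT.
  rewrite -prodr_const; apply: eq_big => l; first by rewrite !inE.
  by rewrite /x => /andP[_ ->]; rewrite addr0.
have EN i : i \notin T -> (root_polyD1 x i)`_k = 0.
  move=> iT; rewrite /root_polyD1 (bigID (mem T))/= mulrC.
  rewrite [X in _ * X](_ : _ = 'X^(k.+1)) ?coefMXn ?ltnSn//.
  rewrite -cT -prodr_const; apply: eq_big => l.
    by case: eqP => [->|_] //=; rewrite (negPf iT).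
  by rewrite /x => /andP[_ ->]; rewrite addr0.
have q0 : 0 < q`_0.
  rewrite -horner_coef0 horner_prod prodr_gt0// => i _.
  by rewrite !hornerE.
have hr : no_pos_root_derivn k (root_poly x).
  apply: no_pos_root_derivn_coefs.
  - exact: monic_root_poly.
  - rewrite size_root_poly ltnS.
    by have := max_card (mem T); rewrite cT card_ord; lia.
  - move=> i _; move: i; rewrite /root_poly.
    apply: (big_ind (fun p : {poly R} => forall i, 0 <= p`_i)).
    + by move=> i; rewrite coefC; case: ifP.
    + move=> p1 p2 h1 h2 i; rewrite coefM sumr_ge0// => a _.
      exact: mulr_ge0.
    + move=> l _ i; rewrite coefD coefX coefC /x.
      by apply: addr_ge0 => //; do 2 case: ifP => // _; exact: ltW.
have := hM x hr; rewrite E coefMXn ltnSn => /(_ erefl).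
rewrite (bigID (mem T))/= [X in _ + X]big1 ?addr0; last first.
  by move=> i /EN ->; rewrite mulr0.
rewrite (eq_bigr (fun i => (\sum_j M i j * x j) * q`_0)); last first.
  by move=> i /ED ->; rewrite coefMXn ltnn subnn.
rewrite -mulr_suml => /eqP; rewrite mulf_eq0 (gt_eqF q0) orbF => /eqP e.
rewrite -[RHS]e.
rewrite exchange_big/= [RHS](bigID (mem T))/= [X in _ = X + _]big1 ?add0r.
  apply: eq_big => j; first by rewrite inE.
  rewrite inE => jT; rewrite mulr_suml.
  by apply: eq_bigr => i _; rewrite /x (negPf jT).
by move=> j jT; rewrite big1// => i _; rewrite /x jT mulr0.
Qed.

(** Doubling the j-th entry of the vector with entries 1 outside T isolates
    column j. *)
Lemma tangent_mx_sum0 k M T j : tangent_mx k M -> #|T| = k.+1 ->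
  j \notin T -> \sum_(i in T) M i j = 0.
Proof.
move=> hM cT jT.
have h1 := tangent_mx_zeros (y := fun=> 1) hM cT (fun=> ltr01).
have h2 := tangent_mx_zeros (y := fun i => 1 + (i == j)%:R) hM cT _.
have /h2 : forall i, 0 < 1 + (i == j)%:R :> R.
  by move=> i; rewrite ltr_wpDr.
under eq_bigr do rewrite mulrDr.
rewrite big_split/= h1 add0r (bigD1 j)/=; last by rewrite inE.
rewrite eqxx mulr1 [X in _ + X]big1 ?addr0//.
by move=> i /andP[_ /negPf ->]; rewrite mulr0.
Qed.

(** Among n - 1 >= k + 2 rows other than j, the sums over any k + 1 of them
    vanish; these sums determine the single entries. *)
Lemma tangent_mx_offdiag k M i j : (k.+3 <= n)%N -> tangent_mx k M -> i != j ->
  M i j = 0.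
Proof.
move=> kn hM ij.
(* a set of k + 2 rows that contains i and avoids j *)
pose W := [set l in take k.+2 (i :: enum (~: [set i; j]))].
have uW : uniq (i :: enum (~: [set i; j])).
  by rewrite /= enum_uniq mem_enum !inE eqxx.
have cW : #|W| = k.+2.
  rewrite cardsE; move/card_uniqP: (take_uniq k.+2 uW) => ->.
  rewrite size_takel//= -cardE cardsCs finset.setCK card_ord cards2 ij.
  by lia.
have jW : j \notin W.
  rewrite inE; apply/negP => /mem_take; rewrite inE eq_sym (negPf ij)/=.
  by rewrite mem_enum !inE eqxx orbT.
have iW : i \in W by rewrite inE /= mem_head.
(* the rows of W other than l form a set of size k + 1, whose sum is zero; so
   every entry equals the total over W, which is then k + 2 times itself *)
have S l : l \in W -> \sum_(a in W) M a j = M l j.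
  move=> lW; rewrite (big_setD1 l)//= (tangent_mx_sum0 hM) ?addr0//.
    by apply/eqP; rewrite -eqSS -cW (cardsD1 l W) lW.
  by rewrite in_setD1 negb_and jW orbT.
have : \sum_(a in W) M a j = (\sum_(a in W) M a j) *+ k.+2.
  rewrite -[in RHS]cW -sumr_const; apply: eq_bigr => a aW.
  by rewrite -(S a aW).
rewrite (S i iW) mulrS => /eqP.
rewrite addrC -subr_eq subrr eq_sym mulrn_eq0/=.
by move=> /eqP.
Qed.


Lemma coef_Xadd1_exp N (i : nat) : (('X + 1) ^+ N : {poly R})`_i = 'C(N, i)%:R.
Proof.
elim: N i => [|N IH] i; first by rewrite expr0 coef1 bin0n.
rewrite exprS mulrDl mul1r coefD coefXM !IH.
by case: i => [|i] /=; rewrite ?bin0 ?add0r// binS natrD addrC.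
Qed.

Lemma coef_Xadd1_expM N (i : nat) (y : R) :
  (('X + y%:P) * ('X + 1) ^+ N : {poly R})`_i =
  (if i == 0%N then 0 else 'C(N, i.-1)%:R) + y * 'C(N, i)%:R.
Proof. by rewrite mulrDl coefD coefXM coefCM !coef_Xadd1_exp. Qed.

Lemma card_ord_neq2 (i j : 'I_n) : i != j ->
  #|[pred l | (l != i) && (l != j)]| = n.-2.
Proof.
move=> ij; rewrite (eq_card (B := ~: [set i; j])) => [|l].
  by rewrite cardsCs finset.setCK card_ord cards2 ij subn2.
by rewrite !inE negb_or.
Qed.

(** The vector with entries 1 and one entry y = - k / (n - k), at j, lies on
    the boundary; for a diagonal matrix its tangency condition compares the
    j-th entry with the mean of the others. It is informative since k > 0
    gives y != 0. *)
Lemma tangent_mx_diag k M j : (0 < k < n)%N -> tangent_mx k M ->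
  (forall i j, i != j -> M i j = 0) -> n%:R * M j j = \sum_i M i i.
Proof.
move=> /andP[k0 kn] hM hd.
pose N := n.-1; have nN : n = N.+1 by rewrite /N; lia.
(* makes the k-th coefficient of ('X + 1)^(n-1) ('X + y) zero *)
pose y : R := - (k%:R / (n - k)%:R).
have d0 : 0 < (n - k)%:R :> R by rewrite ltr0n subn_gt0.
have ynk : y * (n - k)%:R = - k%:R.
  by rewrite /y mulNr divfK// pnatr_eq0; lia.
pose x i := if i == j then y else 1.
have xj : x j = y by rewrite /x eqxx.
have xN i : i != j -> x i = 1 by rewrite /x => /negPf ->.
have E : root_poly x = ('X + y%:P) * ('X + 1) ^+ N.
  rewrite /root_poly (bigD1 j)//= xj; congr (_ * _).
  rewrite (eq_bigr (fun=> 'X + 1)) => [|i /xN -> //].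
  by rewrite prodr_const cardC1 card_ord.
have Ej : root_polyD1 x j = ('X + 1) ^+ N.
  rewrite /root_polyD1 (eq_bigr (fun=> 'X + 1)) => [|i /xN -> //].
  by rewrite prodr_const cardC1 card_ord.
have Ei i : i != j -> root_polyD1 x i = ('X + y%:P) * ('X + 1) ^+ N.-1.
  move=> ij; rewrite /root_polyD1 (bigD1 j)/= ?xj; last by rewrite eq_sym.
  congr (_ * _); rewrite (eq_bigr (fun=> 'X + 1)) => [|l /andP[_ /xN -> //]].
  by rewrite prodr_const card_ord_neq2.
(* C(N,i) / C(N,i+1) increases with i, so the coefficients of index at least k
   are nonnegative once the k-th one is zero *)
have bin_ratio i : ((N - i)%:R * 'C(N, i)%:R = i.+1%:R * 'C(N, i.+1)%:R :> R).
  by rewrite -!natrM mul_bin_left.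
have hr : no_pos_root_derivn k (root_poly x).
  apply: no_pos_root_derivn_coefs.
  - exact: monic_root_poly.
  - by rewrite size_root_poly ltnS ltnW.
  - move=> i ki; rewrite E coef_Xadd1_expM.
    case: i ki => [|i] ki /=; first by lia.
    have [iN|iN] := ltnP i N; last by rewrite [in y * _]bin_small// mulr0 addr0.
    have d1 : 0 < (N - i)%:R :> R by rewrite ltr0n subn_gt0.
    rewrite -(pmulr_rge0 _ (mulr_gt0 d1 d0)).
    have := bin_ratio i; have Ni : (N - i)%:R = n%:R - i.+1%:R :> R.
      by rewrite -natrB ?nN// ?subSS// ltnS ltnW.
    have : 0 <= 'C(N, i.+1)%:R :> R by [].
    have ki' : k%:R <= i.+1%:R :> R by rewrite ler_nat.
    have n0 : 0 <= n%:R :> R by [].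
    move: ('C(N, i.+1)%:R : R) ('C(N, i)%:R : R) => c1 c0 c10 e.
    rewrite [X in 0 <= X](_ : _ = (n - k)%:R * ((N - i)%:R * c0) +
      (N - i)%:R * (y * (n - k)%:R) * c1); last by lra.
    rewrite e ynk Ni natrB ?(ltnW kn)//.
    rewrite [X in 0 <= X](_ : _ = n%:R * c1 * (i.+1%:R - k%:R)); last by lra.
    by rewrite !mulr_ge0// subr_ge0.
have Pk : (root_poly x)`_k = 0.
  rewrite E coef_Xadd1_expM.
  case: k k0 kn y ynk d0 {x xj xN E Ej Ei hr hM} => //=.
  move=> i _ kn y ynk d0.
  apply: (mulfI (lt0r_neq0 d0)); rewrite mulr0 mulrDr mulrA [_ * y]mulrC ynk.
  have -> : (n - i.+1 = N - i)%N by rewrite nN subSS.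
  by rewrite bin_ratio mulNr subrr.
(* the partial derivatives in the directions i != j are all equal *)
have Nbeta i : i != j -> N%:R * (root_polyD1 x i)`_k = - y * 'C(N, k)%:R.
  move=> ij; rewrite Ei// coef_Xadd1_expM (negPf (lt0n_neq0 k0)).
  rewrite mulrDr -natrM mulrCA -natrM (mul_bin_down N k).
  have -> : (N * 'C(N.-1, k.-1) = k * 'C(N, k))%N.
    by rewrite mul_bin_diag prednK.
  have D1 : (N - k)%:R = (n - k)%:R - 1 :> R.
    have -> : (n - k = (N - k).+1)%N by lia.
    by rewrite -natr1 addrK.
  have kE : k%:R = - (y * (n - k)%:R) by rewrite ynk opprK.
  by rewrite !natrM D1 kE; lra.
have yC : y * 'C(N, k)%:R != 0.
  rewrite mulf_neq0// ?pnatr_eq0 -?lt0n ?bin_gt0; last by lia.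
  by rewrite oppr_eq0 mulf_neq0 ?invr_eq0 ?pnatr_eq0; lia.
have hMi i : (\sum_l M i l * x l) = M i i * x i.
  rewrite (bigD1 i)//= big1 ?addr0// => l li.
  by rewrite hd ?mul0r// eq_sym.
have := hM x hr Pk; under eq_bigr do rewrite hMi.
rewrite (bigD1 j)//= Ej coef_Xadd1_exp xj => /(congr1 ( *%R N%:R)).
rewrite mulr0 mulrDr mulr_sumr.
rewrite (eq_bigr (fun i => - (y * 'C(N, k)%:R) * M i i)); last first.
  by move=> i ij; rewrite xN// mulr1 mulrCA Nbeta// mulNr mulrC.
rewrite -mulr_sumr => e; rewrite (bigD1 j)//=.
have -> : n%:R = N%:R + 1 :> R by rewrite [in LHS]nN natr1.
rewrite mulrDl mul1r addrC.
congr (_ + _); apply: (mulfI yC); move: e; lra.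
Qed.

Lemma tangent_mx_scalar k M : (0 < k)%N -> (k.+3 <= n)%N -> tangent_mx k M ->
  M = (n%:R^-1 * \tr M)%:M.
Proof.
move=> k0 kn hM; have hd i j := @tangent_mx_offdiag k M i j kn hM.
apply/matrixP => i j; rewrite mxE; case: eqP => [<-|/eqP /hd -> //].
rewrite /mxtrace -(@tangent_mx_diag k M i _ hM)//; last by rewrite k0; lia.
by rewrite mulKf ?mulr1n// pnatr_eq0; lia.
Qed.

End TangentMatrices.

(** * The Lie algebra of the automorphisms of a cone *)

Section LieAlgebraOfCone.
Variables (R : realType) (V : vectType R).
Implicit Types (f : 'End(V)) (K : set V) (U : {vspace 'End(V)}).

(** Stability for all times is enough: the flow at time - t is the inverse. *)
Lemma lie_Aut_cone_stable K f :
  (forall (t : R) v, K v -> K (lfun_exp (t *: f) v)) -> lie_Aut_cone K f.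
Proof.
move=> h t.
have tK v : lfun_exp (t *: f) (lfun_exp (- t *: f) v) = v.
  by rewrite -{1}(opprK t) lfun_expNK.
split.
  by exists (lfun_exp (- t *: f)) => v; [exact: lfun_expNK|exact: tK].
apply/seteqP; split=> [_ [v Kv <-]|v Kv]; first exact: h.
by exists (lfun_exp (- t *: f) v); [exact: h|exact: tK].
Qed.

Lemma lie_Aut_coneP K f (t : R) v : lie_Aut_cone K f -> K v ->
  K (lfun_exp (t *: f) v).
Proof. by move=> /(_ t)[_ {2}<-] Kv; exists v. Qed.

Lemma lyapunov_rank_dim K U : [set` U] = lie_Aut_cone K ->
  lyapunov_rank K = \dim U.
Proof.
move=> UK; rewrite /lyapunov_rank; congr (\dim _).
apply: (@xget_unique _ _ [set W : {vspace 'End(V)} | [set` W] = _]) => //= W WK.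
apply/vspaceP => f; apply/idP/idP => h.
  by have : [set` W] f by []; rewrite WK -UK.
by have : [set` U] f by []; rewrite UK -WK.
Qed.

End LieAlgebraOfCone.

Section MatrixEntry.
Variables (R : realType) (m n : nat).

Definition mxentry (i : 'I_m) (j : 'I_n) (A : 'M[R]_(m, n)) : R^o := A i j.

Lemma mxentry_linear i j : linear (mxentry i j).
Proof. by move=> a A B; rewrite /mxentry !mxE. Qed.

HB.instance Definition _ i j := GRing.isLinear.Build R 'M[R]_(m, n) R^o _
  (mxentry i j) (mxentry_linear i j).

End MatrixEntry.

Section ExponentialScaling.
Variable R : realType.

Lemma is_derive_expRMl (c t : R) :
  is_derive t (1 : R) (fun s => expR (c * s)) (c * expR (c * t)).
Proof.
have h : is_derive t (1 : R) ( *%R c) c.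
  by have := is_deriveMl c (is_derive_id t (1 : R)); rewrite mulr1.
rewrite mulrC.
exact: (@is_derive1_comp _ expR ( *%R c) t _ _ (is_derive_expR _) h).
Qed.

(** Multiplying by exp (- c t) removes the homothety c from f, so that only
    the velocity of the remaining part of f is left. *)
Lemma is_derive_rescaled_flow (V : vectType R) (f : 'End(V)) (c : R)
    (l : {linear V -> R^o}) v (t : R) :
  is_derive t (1 : R) (fun s => expR (- c * s) * l (lfun_exp (s *: f) v))
    (expR (- c * t) *
     l (f (lfun_exp (t *: f) v) - c *: lfun_exp (t *: f) v)).
Proof.
apply: is_derive_eq.
  exact: is_deriveMf (is_derive_expRMl _ _) (is_derive_lfun_exp f l v t).
rewrite linearB linearZ /=.
have ringE (a E u z : R) : - a * E * u + E * z = E * (z - a * u) by lra.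
exact: ringE.
Qed.

(** If p belongs to a point x, then q belongs to a x: its roots are those of
    p multiplied by a. *)
Lemma no_pos_root_derivn_scale k n (p q : {poly R}) (a : R) : 0 < a ->
  q = a ^+ n *: (p \Po (a^-1 *: 'X)) ->
  no_pos_root_derivn k p -> no_pos_root_derivn k q.
Proof.
move=> a0 -> hp s s0.
have E : (a ^+ n *: (p \Po (a^-1 *: 'X)))^`(k) =
    (a ^+ n * a^-1 ^+ k) *: (p^`(k) \Po (a^-1 *: 'X)).
  elim: k {hp} => [|k IH]; first by rewrite !derivn0 mulr1.
  rewrite !derivnS IH derivZ deriv_comp derivZ derivX -scalerAr mulr1 scalerA.
  by rewrite -mulrA -exprSr.
rewrite E !hornerE horner_comp !hornerE mulf_neq0//; last first.
  by apply: hp; rewrite mulr_gt0// invr_gt0.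
by rewrite mulf_neq0// expf_neq0// ?invr_eq0 gt_eqF.
Qed.

End ExponentialScaling.

(** * The derivative relaxations of the orthant *)

Section Orthant.
Variables (R : realType) (n k : nat).
Implicit Types (x : 'cV[R]_n) (f : 'End('cV[R]_n)).

Lemma orthant_relaxP x : orthant_relax R n k x <->
  no_pos_root_derivn k (root_poly (fun i => x i 0)).
Proof.
apply: (@hyp_cone_derivP _ _ k n) => s; rewrite horner_prod.
rewrite -[in (-1) ^+ n](card_ord n) -prodrN; apply: eq_bigr => i _.
by rewrite !hornerE !mxE mulr1 opprD opprK.
Qed.

Lemma orthant_relax_scale (a : R) x : 0 < a -> orthant_relax R n k x ->
  orthant_relax R n k (a *: x).
Proof.
move=> a0 /orthant_relaxP hx; apply/orthant_relaxP.
apply: (no_pos_root_derivn_scale (n := n) a0 _ hx).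
rewrite /root_poly rmorph_prod/= -mul_polyC rmorphXn/=.
rewrite -[X in _ ^+ X](card_ord n) -prodr_const -big_split/=.
apply: eq_bigr => i _.
rewrite comp_polyD comp_polyX comp_polyC mulrDr mul_polyC scalerA.
by rewrite divff ?gt_eqF// scale1r mxE polyCM.
Qed.

Lemma is_pderive_root_poly (x : 'I_n -> R -> R) (dx : 'I_n -> R) t :
  (forall i, is_derive t (1 : R) (x i) (dx i)) ->
  is_pderive t (fun s => root_poly (x ^~ s))
    (\sum_i (dx i)%:P * root_polyD1 (x ^~ t) i).
Proof.
move=> h; rewrite (eq_bigr (fun i => \prod_j
    (if j == i then (dx j)%:P else 'X + (x j t)%:P))); last first.
  move=> i _; rewrite (bigD1 i)//= eqxx; congr (_ * _).
  by apply: eq_bigr => j /negPf ->.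
apply: is_pderive_prod; first exact: index_enum_uniq.
move=> i; rewrite -[(dx i)%:P]add0r; apply: is_pderiveD.
  exact: is_pderive_cst.
exact: is_pderiveC.
Qed.

(** The tangency principle along exp (t f) x, at t = 0. *)
Lemma lie_orthant_tangent f : (k <= n)%N ->
  lie_Aut_cone (orthant_relax R n k) f ->
  tangent_mx k (\matrix_(i, j) f (delta_mx j 0) i 0).
Proof.
move=> kn hf x hr xk.
pose v : 'cV[R]_n := \col_i x i.
pose X i s := lfun_exp (s *: f) v i 0.
pose dX i s := f (lfun_exp (s *: f) v) i 0.
have dP t := @is_pderive_root_poly X (dX ^~ t) t
  (fun i => is_derive_lfun_exp f (mxentry i 0) v t).
have X0 i : X i 0 = x i by rewrite /X scale0r lfun_exp0 mxE.
have vK : orthant_relax R n k v.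
  by apply/orthant_relaxP; under eq_fun do rewrite mxE.
have Xx : (fun i => X i 0) = x by apply/funext.
have : (\sum_i (dX i 0)%:P * root_polyD1 (fun i => X i 0) i)`_k = 0.
  apply: (coef_pderive_eq0 (k := k) dP) => [t|t|t|].
  - exact: monic_root_poly.
  - by rewrite size_root_poly ltnS.
  - apply/(orthant_relaxP (lfun_exp (t *: f) v)).
    exact: (lie_Aut_coneP t hf vK).
  - by rewrite Xx.
rewrite coef_sum Xx => e; rewrite -[RHS]e.
apply: eq_bigr => i _; rewrite coefCM; congr (_ * _).
rewrite /dX scale0r lfun_exp0 [v in RHS]matrix_sum_delta.
rewrite linear_sum summxE; apply: eq_bigr => j _.
by rewrite big_ord1 !mxE linearZ mxE mulrC.
Qed.

Lemma lie_orthant : (0 < k)%N -> (k.+3 <= n)%N ->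
  [set` <[\1%VF : 'End('cV[R]_n)]>%VS] = lie_Aut_cone (orthant_relax R n k).
Proof.
move=> k0 kn; apply/seteqP; split=> f /=.
  move=> /vlineP[c ->]; apply: lie_Aut_cone_stable => t v hv.
  suff -> : lfun_exp (t *: (c *: \1%VF)) v = expR (c * t) *: v.
    by apply: orthant_relax_scale => //; exact: expR_gt0.
  apply/matrixP => i j; rewrite (ord1 j) mxE.
  pose h s := expR (- c * s) * mxentry i 0 (lfun_exp (s *: (c *: \1%VF)) v).
  have dh s : is_derive s (1 : R) h 0.
    apply: is_derive_eq; first exact: is_derive_rescaled_flow.
    by rewrite scale_lfunE id_lfunE subrr linear0 mulr0.
  have h0 : h 0 = v i 0.
    by rewrite /h (mulr0 (- c)) expR0 (scale0r (_ : 'End(_))) lfun_exp0 mul1r.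
  rewrite -h0 -(is_derive_0_is_cst t 0 dh) /h mulrA -expRD mulNr subrr expR0.
  by rewrite mul1r.
move=> hf; have hM := lie_orthant_tangent (ltnW (ltnW (ltnW kn))) hf.
have := tangent_mx_scalar k0 kn hM; set c := _ * _ => Mc.
apply/vlineP; exists c; apply/lfunP => v; rewrite scale_lfunE id_lfunE.
apply/matrixP => i j; rewrite (ord1 j) mxE.
rewrite [v in LHS]matrix_sum_delta linear_sum summxE (bigD1 i)//=.
have fE a b : f (delta_mx a 0) b 0 = (b == a)%:R * c.
  by have /matrixP/(_ b a) := Mc; rewrite !mxE => ->; rewrite mulr_natl.
rewrite big_ord1 linearZ mxE fE eqxx mul1r mulrC big1 ?addr0// => a /negPf ai.
by rewrite big_ord1 linearZ mxE fE eq_sym ai mul0r mulr0.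
Qed.

End Orthant.

(** * The polynomial det (s + X) *)

Section ShiftedDeterminant.
Variables (R : realType) (n : nat).
Implicit Types (X U : 'M[R]_n).

Definition shift_det X : {poly R} := char_poly (- X).

Lemma shift_detE X : shift_det X = \det ('X%:M + map_mx polyC X).
Proof. by rewrite /shift_det /char_poly /char_poly_mx map_mxN opprK. Qed.

Lemma horner_shift_det X (s : R) : (shift_det X).[s] = \det (s%:M + X).
Proof.
rewrite shift_detE -/(horner_eval s _) -det_map_mx; congr (\det _).
apply/matrixP => i j; rewrite !mxE /= /horner_eval.
by case: eqP => _; rewrite ?mulr1n ?mulr0n !hornerE.
Qed.

Lemma shift_det_diag (x : 'I_n -> R) :
  shift_det (diag_mx (\row_i x i)) = root_poly x.
Proof.
rewrite shift_detE map_diag_mx -diag_const_mx -linearD/= det_diag.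
by apply: eq_bigr => i _; rewrite !mxE.
Qed.

Lemma shift_det_conj U X : U^T *m U = 1%:M ->
  shift_det (U^T *m X *m U) = shift_det X.
Proof.
move=> UU; rewrite !shift_detE.
have -> : 'X%:M + map_mx polyC (U^T *m X *m U) =
    map_mx polyC U^T *m ('X%:M + map_mx polyC X) *m map_mx polyC U.
  rewrite mulmxDr mulmxDl !map_mxM; congr (_ + _).
  by rewrite scalar_mxC -mulmxA -map_mxM UU map_mx1 mulmx1.
by rewrite !det_mulmx mulrAC -det_mulmx -map_mxM UU map_mx1 det1 mul1r.
Qed.

Lemma shift_det_scale (a : R) X : 0 < a ->
  shift_det (a *: X) = a ^+ n *: (shift_det X \Po (a^-1 *: 'X)).
Proof.
move=> a0; rewrite !shift_detE.
rewrite -/(comp_poly _ _) -det_map_mx -mul_polyC rmorphXn/= -detZ.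
congr (\det _); apply/matrixP => i j; rewrite !mxE.
rewrite comp_polyD comp_polyC mulrDr polyCM; congr (_ + _).
case: eqP => _; rewrite ?mulr0n ?mulr1n ?rmorph0 ?mulr0//.
by rewrite comp_polyX mul_polyC scalerA divff ?scale1r// gt_eqF.
Qed.

Lemma is_pderive_shift_det (X : R -> 'M[R]_n) (dX : 'M[R]_n) t :
  (forall i j, is_derive t (1 : R) (fun s => X s i j) (dX i j)) ->
  is_pderive t (fun s => shift_det (X s))
    (\tr (\adj ('X%:M + map_mx polyC (X t)) *m map_mx polyC dX)).
Proof.
move=> h; under eq_fun do rewrite shift_detE.
apply: is_pderive_det => i j.
rewrite !mxE -[(dX i j)%:P]add0r.
under eq_fun do rewrite !mxE.
by apply: is_pderiveD; [exact: is_pderive_cst|exact: is_pderiveC].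
Qed.

(** The isospectral flow X' = A X - X A: by Jacobi's formula the derivative
    of the polynomial is the trace of adj Y (A Y - Y A), which is zero
    because adj Y Y = Y adj Y is scalar. *)
Lemma shift_det_lax (X : R -> 'M[R]_n) (A : 'M[R]_n) :
  (forall t i j, is_derive t (1 : R) (fun s => X s i j)
     ((A *m X t - X t *m A) i j)) ->
  forall t, shift_det (X t) = shift_det (X 0).
Proof.
move=> h t; apply/polyP => l.
apply: (is_derive_0_is_cst (f := fun s => (shift_det (X s))`_l)) => s.
have := @is_pderive_shift_det X _ s (h s) l.
set Y := 'X%:M + _; set A' := map_mx polyC A.
have -> : map_mx polyC (A *m X s - X s *m A) = A' *m Y - Y *m A'.
  rewrite map_mxB !map_mxM mulmxDr mulmxDl scalar_mxC.
  by rewrite opprD addrACA subrr add0r.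
rewrite mulmxBr linearB/= mulmxA [\tr (_ *m Y)]mxtrace_mulC !mulmxA.
by rewrite mul_mx_adj mul_adj_mx subrr coef0.
Qed.

(** At a diagonal matrix only the diagonal of the velocity matters, as for
    vectors: the off-diagonal cofactors vanish. *)
Lemma trace_adj_diag (x : 'I_n -> R) (D : 'M[R]_n) :
  \tr (\adj ('X%:M + map_mx polyC (diag_mx (\row_i x i))) *m map_mx polyC D) =
  \sum_i (D i i)%:P * root_polyD1 x i.
Proof.
set Y := _ + _.
have YE : Y = diag_mx (\row_i ('X + (x i)%:P)).
  rewrite /Y map_diag_mx -diag_const_mx -linearD/=; congr diag_mx.
  by apply/rowP => i; rewrite !mxE.
have nz i : 'X + (x i)%:P != 0 by rewrite -size_poly_eq0 size_XaddC.
have adjE i j : \adj Y i j * ('X + (x j)%:P) = (root_poly x *+ (i == j)).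
  have /matrixP/(_ i j) := mul_adj_mx Y.
  rewrite {2}YE mul_mx_diag !mxE => ->; rewrite YE det_diag.
  by congr (_ *+ _); apply: eq_bigr => l _; rewrite mxE.
have adj0 i j : i != j -> \adj Y i j = 0.
  move=> /negPf ij; have /eqP := adjE i j; rewrite ij mulr0n mulf_eq0.
  by rewrite (negPf (nz j)) orbF => /eqP.
rewrite /mxtrace; apply: eq_bigr => i _; rewrite mxE (bigD1 i)//=.
rewrite big1 ?addr0 => [|j ji]; last by rewrite adj0 ?mul0r// eq_sym.
rewrite [map_mx _ _ _ _]mxE mulrC; congr (_ * _); apply: (mulIf (nz i)).
by rewrite adjE eqxx mulr1n /root_poly (bigD1 i)//= mulrC.
Qed.

End ShiftedDeterminant.

(** * Orthonormal frames *)

Section OrthonormalFrames.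
Variables (R : realType) (n : nat).
Implicit Types (u v w z : 'cV[R]_n).

Definition dot u v : R := (u^T *m v) 0 0.

Lemma dotE u v : u^T *m v = (dot u v)%:M.
Proof. by rewrite [LHS]mx11_scalar. Qed.

Lemma dotC u v : dot u v = dot v u.
Proof. by rewrite /dot -[in LHS](trmxK v) -trmx_mul mxE. Qed.

Lemma dotDl (a : R) u v w : dot (a *: u + v) w = a * dot u w + dot v w.
Proof. by rewrite /dot linearP/= mulmxDl -scalemxAl !mxE. Qed.

Lemma dotDr (a : R) u v w : dot w (a *: u + v) = a * dot w u + dot w v.
Proof. by rewrite dotC dotDl !(dotC w). Qed.

Lemma dotBl u v w : dot (u - v) w = dot u w - dot v w.
Proof. by rewrite addrC -scaleN1r dotDl mulN1r addrC. Qed.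

Lemma dotBr u v w : dot w (u - v) = dot w u - dot w v.
Proof. by rewrite dotC dotBl !(dotC w). Qed.

Lemma dotZ (a : R) u v : dot (a *: u) v = a * dot u v.
Proof. by rewrite /dot linearZ/= -scalemxAl mxE. Qed.

Lemma dotZr (a : R) u v : dot u (a *: v) = a * dot u v.
Proof. by rewrite dotC dotZ dotC. Qed.

Lemma dot_ge0 u : 0 <= dot u u.
Proof.
by rewrite /dot mxE sumr_ge0// => i _; rewrite mxE -expr2 sqr_ge0.
Qed.

Lemma dot_eq0 u : dot u u = 0 -> u = 0.
Proof.
rewrite /dot mxE => /eqP; rewrite psumr_eq0 => [/allP h|i _]; last first.
  by rewrite mxE -expr2 sqr_ge0.
apply/matrixP => i j; rewrite (ord1 j) [RHS]mxE.
by have := h i (mem_index_enum _); rewrite mxE -expr2 sqrf_eq0 => /eqP.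
Qed.

Definition basis_vec (i : 'I_n) : 'cV[R]_n := delta_mx i 0.

Lemma dot_basis i j : dot (basis_vec i) (basis_vec j) = (i == j)%:R.
Proof.
rewrite /dot /basis_vec trmx_delta mul_delta_mx_cond.
by case: (i == j); rewrite ?mulr1n ?mulr0n mxE ?eqxx.
Qed.

Lemma mul_basis (A : 'M[R]_n) i : A *m basis_vec i = col i A.
Proof. by rewrite colE. Qed.

(** The reflection in the hyperplane orthogonal to a - b exchanges the unit
    vectors a and b. *)
Lemma reflection_exists (a b : 'cV[R]_n) : dot a a = 1 -> dot b b = 1 ->
  exists H : 'M[R]_n, [/\ H^T = H, H *m H = 1%:M, H *m a = b &
    forall z, dot a z = 0 -> dot b z = 0 -> H *m z = z].
Proof.
move=> aa bb; have [<-|ab] := eqVneq a b.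
  by exists 1%:M; split; rewrite ?trmx1 ?mul1mx// => z _ _; rewrite mul1mx.
pose w := a - b; pose N := dot w w.
have N0 : N != 0.
  by apply: contra_neq ab => /dot_eq0/eqP; rewrite subr_eq0 => /eqP.
have NE : N = 2 * (1 - dot a b).
  rewrite /N /w dotBl !dotBr aa bb (dotC b a); lra.
pose H := 1%:M - (2 / N) *: (w *m w^T).
have HE z : H *m z = z - (2 / N * dot w z) *: w.
  rewrite /H mulmxBl mul1mx -scalemxAl -mulmxA dotE mul_mx_scalar.
  by rewrite scalerA.
exists H; split.
- by rewrite /H linearB/= trmx1 linearZ/= trmx_mul trmxK.
- rewrite {1}/H mulmxBl mul1mx -scalemxAl -mulmxA.
  have -> : w^T *m H = - w^T.
    rewrite /H mulmxBr mulmx1 -scalemxAr mulmxA dotE mul_scalar_mx scalerA.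
    by rewrite -/N divfK// scaler_nat mulr2n opprD addNKr.
  by rewrite mulmxN scalerN opprK /H subrK.
- rewrite HE /w dotBl aa (dotC b a) -/w.
  have -> : 2 / N * (1 - dot a b) = 1 by rewrite mulrAC -NE divff.
  by rewrite scale1r /w subKr.
- move=> z az bz; rewrite HE /w dotBl az bz subr0 mulr0.
  by rewrite scale0r subr0.
Qed.

(** Two reflections suffice: the first carries the i-th basis vector to u,
    the second corrects the j-th one while fixing the i-th. *)
Lemma frame_exists i j u v : i != j -> dot u u = 1 -> dot v v = 1 ->
  dot u v = 0 -> exists U : 'M[R]_n, [/\ U^T *m U = 1%:M, col i U = u &
    col j U = v].
Proof.
move=> ij uu vv uv.
have e l : dot (basis_vec l) (basis_vec l) = 1 by rewrite dot_basis eqxx.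
have [H [HT HH Hi _]] := reflection_exists (e i) uu.
pose v' := H *m v.
have v'v' : dot v' v' = 1.
  by rewrite /dot /v' trmx_mul HT mulmxA -[_ *m H *m H]mulmxA HH mulmx1.
have iv' : dot v' (basis_vec i) = 0.
  rewrite /dot /v' trmx_mul HT -mulmxA Hi -/(dot v u) dotC.
  exact: uv.
have [G [GT GG Gj Gz]] := reflection_exists (e j) v'v'.
exists (H *m G); split.
- by rewrite trmx_mul HT GT mulmxA -[_ *m H *m H]mulmxA HH mulmx1 GG.
- by rewrite -mul_basis -mulmxA Gz// dot_basis eq_sym (negPf ij).
- by rewrite -mul_basis -mulmxA Gj /v' mulmxA HH mul1mx.
Qed.

Lemma frame_exists1 i u : dot u u = 1 ->
  exists U : 'M[R]_n, U^T *m U = 1%:M /\ col i U = u.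
Proof.
move=> uu.
have e l : dot (basis_vec l) (basis_vec l) = 1 by rewrite dot_basis eqxx.
have [H [HT HH Hi _]] := reflection_exists (e i) uu.
by exists H; rewrite HT HH -mul_basis.
Qed.

End OrthonormalFrames.

(** * Linear maps that act as commutators on symmetric matrices *)

Section Polarization.
Variables (R : realType) (n : nat).
Implicit Types (L : {linear 'M[R]_n -> 'M[R]_n}) (x y z w : 'cV[R]_n).

(** The polarization of the quartic form z^T L (x x^T) z; on repeated
    arguments it is twice that form. *)
Definition polar L x y z w : R :=
  (z^T *m L (x *m y^T + y *m x^T) *m w) 0 0.

Definition preserves_sym L := forall X, X^T = X -> (L X)^T = L X.

Lemma polarC12 L x y z w : polar L x y z w = polar L y x z w.
Proof. by rewrite /polar addrC. Qed.

Lemma polarC34 L x y z w : preserves_sym L ->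
  polar L x y z w = polar L x y w z.
Proof.
move=> hL; rewrite /polar -[LHS]trace_mx11 -mxtrace_tr trace_mx11.
rewrite !trmx_mul trmxK hL ?mulmxA//.
by rewrite linearD/= !trmx_mul !trmxK addrC.
Qed.

Lemma polarDl L (a : R) x x' y z w :
  polar L (a *: x + x') y z w = a * polar L x y z w + polar L x' y z w.
Proof.
rewrite /polar.
have -> : (a *: x + x') *m y^T + y *m (a *: x + x')^T =
    a *: (x *m y^T + y *m x^T) + (x' *m y^T + y *m x'^T).
  by rewrite linearP/= mulmxDl mulmxDr -scalemxAl -scalemxAr addrACA scalerDr.
by rewrite linearP mulmxDr mulmxDl -scalemxAr -scalemxAl !mxE.
Qed.

Lemma polarDr L (a : R) x y z w w' :
  polar L x y z (a *: w + w') = a * polar L x y z w + polar L x y z w'.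
Proof. by rewrite /polar mulmxDr -scalemxAr !mxE. Qed.

Lemma polarZr L (a : R) x y z w :
  polar L x y z (a *: w) = a * polar L x y z w.
Proof. by rewrite /polar -scalemxAr !mxE. Qed.

Lemma polar_scale L (a c : R) x z :
  polar L (a *: x) (a *: x) (c *: z) (c *: z) =
  a * a * (c * c) * polar L x x z z.
Proof.
rewrite /polar.
have -> : (a *: x) *m (a *: x)^T + (a *: x) *m (a *: x)^T =
    (a * a) *: (x *m x^T + x *m x^T).
  by rewrite linearZ/= -scalemxAl -scalemxAr scalerA scalerDr.
rewrite [L _]linearZ [(c *: z)^T]linearZ /= -!scalemxAr -!scalemxAl !scalerA.
by rewrite mxE; congr (_ * _); lra.
Qed.

(** L (x x^T), read as a quadratic form, vanishes on x and on the orthogonal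
    complement of x. *)
Definition sq_vanishing L :=
  (forall x z, dot x z = 0 -> polar L x x z z = 0) /\
  (forall x, polar L x x x x = 0).

Section Consequences.
Variable L : {linear 'M[R]_n -> 'M[R]_n}.
Hypotheses (hL : preserves_sym L) (hv : sq_vanishing L).
Local Notation b := (polar L).

Let bC x y z w : b x y z w = b x y w z. Proof. exact: polarC34. Qed.

Let bsq12 s x y z w : b (s *: y + x) (s *: y + x) z w =
  b x x z w + 2 * s * b x y z w + s ^+ 2 * b y y z w.
Proof.
rewrite polarDl !(polarC12 _ _ (s *: y + x)) !polarDl (polarC12 _ y x); lra.
Qed.

Let bsq34 s x y z w : b x y (s *: w + z) (s *: w + z) =
  b x y z z + 2 * s * b x y z w + s ^+ 2 * b x y w w.
Proof.
rewrite polarDr !(bC _ _ (s *: w + z)) !polarDr (bC _ _ w z); lra.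
Qed.

Lemma polar_sq_orth x z w : dot x z = 0 -> dot x w = 0 -> b x x z w = 0.
Proof.
move=> xz xw; have [h _] := hv.
have := h x (1 *: w + z); rewrite dotDr xz xw mulr0 addr0 => /(_ erefl).
rewrite bsq34 h// h//; lra.
Qed.

Lemma polar_orth x y z w : dot x z = 0 -> dot x w = 0 -> dot y z = 0 ->
  dot y w = 0 -> b x y z w = 0.
Proof.
move=> xz xw yz yw.
have := @polar_sq_orth (1 *: y + x) z w.
rewrite !dotDl xz xw yz yw mulr0 addr0 => /(_ erefl erefl).
by rewrite bsq12 !polar_sq_orth//; lra.
Qed.

(** The vectors s y + x and s x - y are orthogonal for every s; comparing
    the powers of s in the vanishing condition relates the polar values. *)
Lemma polar_triple x y z : dot x x = dot y y -> dot x y = 0 -> dot x z = 0 ->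
  dot y z = 0 -> b x x x z = 2 * b x y y z.
Proof.
move=> xy_norm xy xz yz.
have E s : s * (b x x x z - 2 * b x y y z) +
    s ^+ 2 * (2 * b x y x z - b y y y z) = 0.
  have := @polar_sq_orth (s *: y + x) z (s *: x + (-1) *: y).
  have uz : dot (s *: y + x) z = 0 by rewrite dotDl xz yz mulr0 addr0.
  have uv : dot (s *: y + x) (s *: x + (-1) *: y) = 0.
    by rewrite !dotDl !dotDr !dotZr (dotC y x) xy xy_norm; lra.
  move=> /(_ uz uv).
  rewrite bsq12 !polarDr !polarZr (polar_sq_orth xz xy)//.
  have -> : b y y z x = 0 by rewrite polar_sq_orth// dotC.
  rewrite (bC x x z x) (bC x y z x) (bC x y z y) (bC y y z y); lra.
have := E 1; have := E (-1); lra.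
Qed.

(** Again with s y + x and s x - y, now also using the vanishing on s y + x
    itself. The first equation is what makes the matrix of the commutator
    skew-symmetric. *)
Lemma polar_pair x y : dot x x = dot y y -> dot x y = 0 ->
  [/\ b y y y x = - b x x x y, b x y x y = 0, b x y y y = b x x x y &
    b x y x x = - b x x x y].
Proof.
move=> xy_norm xy; have [h1 h2] := hv.
have yx : dot y x = 0 by rewrite dotC.
(* the vanishing condition for the orthogonal pair s y + x, s x - y *)
have D s : - s * b x x x y + s * b x y y y - 2 * s ^+ 2 * b x y x y +
    s ^+ 3 * b x y x x - s ^+ 3 * b y y y x = 0.
  have := h1 (s *: y + x) (s *: x + (-1) *: y).
  have uv : dot (s *: y + x) (s *: x + (-1) *: y) = 0.
    by rewrite !dotDl !dotDr !dotZr yx xy xy_norm; lra.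
  move=> /(_ uv).
  rewrite bsq12 !polarDr !polarZr !(bC _ _ (_ + _)) !polarDr !polarZr.
  rewrite (h2 x) (h2 y) (h1 _ _ xy) (h1 _ _ yx).
  rewrite (bC x x y x) (bC x y y x) (bC y y x y); lra.
(* the vanishing condition on s y + x itself *)
have E s : s * b x x x y + s * b x y x x + 2 * s ^+ 2 * b x y x y +
    s ^+ 3 * b x y y y + s ^+ 3 * b y y y x = 0.
  have := h2 (s *: y + x).
  rewrite bsq12 !bsq34 (h2 x) (h2 y) (h1 _ _ xy) (h1 _ _ yx).
  rewrite (bC y y x y); lra.
have := D 1; have := D (-1); have := D 2; have := E 1; have := E (-1).
have := E 2; split; lra.
Qed.

Let e := @basis_vec R n.

(** By the relations above, the values on basis vectors are all determined
    by those with three equal arguments. *)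
Lemma polar_basis0 : (forall i k, b (e i) (e i) (e i) (e k) = 0) ->
  forall i j k l, b (e i) (e j) (e k) (e l) = 0.
Proof.
move=> h0.
have o i j : i != j -> dot (e i) (e j) = 0.
  by rewrite dot_basis => /negPf ->.
have n1 i j : dot (e i) (e i) = dot (e j) (e j) by rewrite !dot_basis !eqxx.
have hdiag i k l : b (e i) (e i) (e k) (e l) = 0.
  have [->|ik] := eqVneq k i; first exact: h0.
  have [->|il] := eqVneq l i; first by rewrite bC h0.
  by apply: polar_sq_orth; rewrite o// eq_sym.
have hpair i j : i != j -> b (e i) (e j) (e i) (e i) = 0 /\
    b (e i) (e j) (e i) (e j) = 0.
  by move=> ij; have [_ -> _ ->] := polar_pair (n1 i j) (o _ _ ij);
    rewrite h0 oppr0.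
have hone i j l : i != j -> b (e i) (e j) (e i) (e l) = 0.
  move=> ij; have [->|il] := eqVneq l i; first by have [] := hpair _ _ ij.
  have [->|jl] := eqVneq l j; first by have [] := hpair _ _ ij.
  have := @polar_triple (e j) (e i) (e l) (n1 _ _).
  rewrite !o// 1?eq_sym// h0 (polarC12 _ (e j)) => /(_ erefl erefl erefl).
  by lra.
move=> i j k l; have [->|ij] := eqVneq i j; first exact: hdiag.
have [->|ik] := eqVneq k i; first exact: hone.
have [->|jk] := eqVneq k j; first by rewrite polarC12 hone// eq_sym.
have [->|il] := eqVneq l i; first by rewrite bC hone.
have [->|jl] := eqVneq l j; first by rewrite bC polarC12 hone// eq_sym.
by apply: polar_orth; rewrite o// eq_sym.
Qed.

Lemma linear_sym_eq0 : (forall i k, b (e i) (e i) (e i) (e k) = 0) ->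
  forall X, X^T = X -> L X = 0.
Proof.
move=> /polar_basis0 h X sX.
have -> : X = \sum_i \sum_j (2^-1 * X i j) *:
    (e i *m (e j)^T + e j *m (e i)^T).
  have eE i j : e i *m (e j)^T = delta_mx i j.
    by rewrite trmx_delta mul_delta_mx.
  have {1}-> : X = 2^-1 *: (X + X^T).
    rewrite sX -mulr2n -[X *+ 2]scaler_nat.
    by rewrite scalerA mulVf ?scale1r.
  rewrite {1 2}(matrix_sum_delta X) linear_sum -big_split/= scaler_sumr.
  apply: eq_bigr => i _; rewrite linear_sum -big_split/= scaler_sumr.
  apply: eq_bigr => j _.
  by rewrite linearZ/= trmx_delta -scalerDr scalerA !eE.
rewrite linear_sum big1// => i _; rewrite linear_sum big1// => j _.
rewrite linearZ/=.
suff -> : L (e i *m (e j)^T + e j *m (e i)^T) = 0 by rewrite scaler0.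
apply/matrixP => k l; have := h i j k l.
rewrite /polar -mulmxA mul_basis /e /basis_vec trmx_delta -rowE.
by rewrite !mxE.
Qed.

End Consequences.

(** The entries of A are read off from L on the diagonal matrix units. Then
    X |-> L X - (A X - X A) satisfies the same vanishing conditions, and in
    addition its polar values with three equal basis vectors are zero, so it
    is zero. *)
Lemma commutator_of_sq_vanishing L : preserves_sym L -> sq_vanishing L ->
  exists A, A^T = - A /\ forall X, X^T = X -> L X = A *m X - X *m A.
Proof.
move=> hL [h1 h2]; pose e := @basis_vec R n.
pose A := \matrix_(k, i) (2^-1 * polar L (e i) (e i) (e i) (e k)).
have n1 i j : dot (e i) (e i) = dot (e j) (e j) by rewrite !dot_basis !eqxx.
have Pneg i k : i != k -> polar L (e i) (e i) (e i) (e k) =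
    - polar L (e k) (e k) (e k) (e i).
  move=> ik; have o : dot (e k) (e i) = 0.
    by rewrite dot_basis eq_sym (negPf ik).
  by have [-> _ _ _] := polar_pair hL (conj h1 h2) (n1 k i) o.
have Asym : A^T = - A.
  apply/matrixP => i k; rewrite !mxE; have [->|ik] := eqVneq i k.
    by rewrite h2 mulr0 oppr0.
  by rewrite -mulrN Pneg.
pose L' : {linear 'M[R]_n -> 'M[R]_n} := L \- (mulmx A \- mulmxr A).
have L'E X : L' X = L X - (A *m X - X *m A) by [].
have hL' : preserves_sym L'.
  move=> X sX; rewrite L'E !linearB/= hL// !trmx_mul Asym sX.
  by rewrite mulmxN mulNmx; congr (_ + _); rewrite !opprK addrC.
have adE x z w : (z^T *m (A *m (x *m x^T) - (x *m x^T) *m A) *m w) 0 0 =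
    dot z (A *m x) * dot x w - dot z x * dot x (A *m w).
  rewrite mulmxBr mulmxBl.
  have -> : z^T *m (A *m (x *m x^T)) *m w = (z^T *m (A *m x)) *m (x^T *m w).
    by rewrite !mulmxA.
  have -> : z^T *m (x *m x^T *m A) *m w = (z^T *m x) *m (x^T *m (A *m w)).
    by rewrite !mulmxA.
  by rewrite !dotE -!scalar_mxM !mxE !mulr1n.
have polE x z w : polar L' x x z w = polar L x x z w -
    2 * (dot z (A *m x) * dot x w - dot z x * dot x (A *m w)).
  rewrite /polar L'E -adE.
  set Y := x *m x^T; have -> : A *m (Y + Y) - (Y + Y) *m A =
      2 *: (A *m Y - Y *m A).
    by rewrite mulmxDr mulmxDl opprD addrACA -[RHS]/(_ *: _) scaler_nat mulr2n.
  by rewrite mulmxBr mulmxBl -scalemxAr -scalemxAl !mxE.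
have hv' : sq_vanishing L'.
  split=> [x z xz|x]; rewrite polE.
    by rewrite h1// (dotC z x) xz !(mulr0, mul0r) subrr mulr0 subrr.
  by rewrite h2 (mulrC (dot x x)) subrr mulr0 subrr.
exists A; split=> // X sX; apply/eqP; rewrite -subr_eq0 -L'E; apply/eqP.
apply: (linear_sym_eq0 hL' hv') => // i k.
have dA j l : dot (e j) (A *m e l) = 2^-1 * polar L (e l) (e l) (e l) (e j).
  by rewrite /dot mul_basis /e /basis_vec trmx_delta -rowE !mxE.
rewrite polE !dA !dot_basis eqxx; have [<-|ik] := eqVneq i k.
  by rewrite h2; lra.
by rewrite (Pneg i k ik) mulr0n mulr1n; lra.
Qed.

End Polarization.

(** * The derivative relaxations of the cone of semidefinite matrices *)

Section SymmetricCone.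
Variables (R : realType) (n k : nat).
Local Notation S := (subvs_of (sym_space R n)).
Implicit Types (X : S) (f : 'End(S)) (U : 'M[R]_n).

Lemma vsval_sym X : (vsval X)^T = vsval X.
Proof. exact/sym_spaceP/subvsP. Qed.

Lemma vsproj_sym (Y : 'M[R]_n) :
  Y^T = Y -> vsval (vsproj (sym_space R n) Y) = Y.
Proof. by move=> /sym_spaceP; exact: vsprojK. Qed.

Lemma psd_relaxP X :
  psd_relax R n k X <-> no_pos_root_derivn k (shift_det (vsval X)).
Proof.
apply: (@hyp_cone_derivP _ _ k n) => s.
rewrite horner_shift_det -detZ linearB linearZ /=; congr (\det _).
by rewrite scaleN1r opprD -[(- s)%:M]scalemx1 scaleNr opprK.
Qed.

Lemma psd_relax_scale (a : R) X : 0 < a ->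
  psd_relax R n k X -> psd_relax R n k (a *: X).
Proof.
move=> a0 /psd_relaxP hX; apply/psd_relaxP.
apply: (no_pos_root_derivn_scale a0 _ hX).
by rewrite linearZ /= shift_det_scale.
Qed.

(** The linear functionals against which the flow on symmetric matrices is
    tested. *)
Definition sym_entry (W : 'M[R]_n) i j (X : S) : R^o :=
  mxentry i j (W^T *m vsval X *m W).

Lemma sym_entry_linear W i j : linear (sym_entry W i j).
Proof.
move=> a X Y; rewrite /sym_entry [vsval _]linearP/= mulmxDr mulmxDl.
by rewrite -scalemxAr -scalemxAl linearP.
Qed.

HB.instance Definition _ W i j := GRing.isLinear.Build R S R^o _
  (sym_entry W i j) (sym_entry_linear W i j).

Lemma sym_entry1 i j X : sym_entry 1%:M i j X = vsval X i j.
Proof. by rewrite /sym_entry trmx1 mul1mx mulmx1. Qed.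

(** After rescaling by exp (- c t) the flow is isospectral, so det (s + X)
    is constant along it; the cone is invariant under positive homotheties. *)
Lemma lie_psd_commutator f (c : R) (A : 'M[R]_n) :
  (forall X, vsval (f X) = c *: vsval X + (A *m vsval X - vsval X *m A)) ->
  lie_Aut_cone (psd_relax R n k) f.
Proof.
move=> fE; apply: lie_Aut_cone_stable => t v hv.
pose Z s : 'M[R]_n := expR (- c * s) *: vsval (lfun_exp (s *: f) v).
have dZ s i j : is_derive s (1 : R) (fun s => Z s i j)
    ((A *m Z s - Z s *m A) i j).
  have -> : (fun s => Z s i j) =
      (fun s => expR (- c * s) * sym_entry 1%:M i j (lfun_exp (s *: f) v)).
    by apply/funext => r; rewrite /Z mxE sym_entry1.
  apply: is_derive_eq; first exact: is_derive_rescaled_flow.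
  rewrite /= sym_entry1 linearB linearZ /= fE scalerN addrAC subrr add0r /Z.
  by rewrite -scalemxAr -scalemxAl -scalerBr [RHS]mxE.
have Zt := shift_det_lax dZ t.
have Z0 : Z 0 = vsval v.
  by rewrite /Z (mulr0 (- c)) expR0 scale1r (scale0r (_ : 'End(_))) lfun_exp0.
have E : lfun_exp (t *: f) v =
    expR (c * t) *: (expR (- c * t) *: lfun_exp (t *: f) v).
  by rewrite scalerA -expRD mulNr subrr expR0 scale1r.
rewrite E; apply: psd_relax_scale; first exact: expR_gt0.
apply/psd_relaxP; rewrite linearZ /= -/(Z t) Zt Z0.
exact/psd_relaxP.
Qed.

Section LieElements.
Variable f : 'End(S).
Hypothesis hf : lie_Aut_cone (psd_relax R n k) f.
Hypotheses (k0 : (0 < k)%N) (kn : (k.+3 <= n)%N).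

(** Endomorphisms of the space of symmetric matrices are extended to all
    matrices by means of a projection, so as to apply them to rank one
    matrices without proofs of symmetry. *)
Definition lift_sym (g : 'End(S)) (Y : 'M[R]_n) : 'M[R]_n :=
  vsval (g (vsproj (sym_space R n) Y)).

Lemma lift_sym_linear g : linear (lift_sym g).
Proof. by move=> a Y Z; rewrite /lift_sym !linearP. Qed.

HB.instance Definition _ g := GRing.isLinear.Build R 'M[R]_n 'M[R]_n _
  (lift_sym g) (lift_sym_linear g).

Local Notation F := (lift_sym f).

(** To first order, the flow of f moves the diagonal matrix with diagonal x
    in the frame U so that its diagonal has velocity frame_mx U times x. *)
Definition frame_mx U : 'M[R]_n := \matrix_(i, j)
  (U^T *m F (col j U *m (col j U)^T) *m U) i i.

Lemma diag_decomp U (x : 'I_n -> R) : U *m diag_mx (\row_i x i) *m U^T =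
  \sum_j x j *: (col j U *m (col j U)^T).
Proof.
apply/matrixP => a b; rewrite summxE mxE; apply: eq_bigr => j _.
by rewrite mul_mx_diag !mxE big_ord1 !mxE mulrAC mulrC.
Qed.

(** At a diagonal matrix of the frame, the derivative of det (s + X) only
    sees the diagonal of the velocity: the condition is the one for vectors. *)
Lemma frame_mx_tangent U : U^T *m U = 1%:M -> tangent_mx k (frame_mx U).
Proof.
move=> UU x hr xk.
pose X0 := U *m diag_mx (\row_i x i) *m U^T.
have sX0 : X0^T = X0 by rewrite /X0 !trmx_mul trmxK tr_diag_mx mulmxA.
pose v := vsproj (sym_space R n) X0.
have vE : vsval v = X0 by rewrite vsproj_sym.
have UX0 : U^T *m X0 *m U = diag_mx (\row_i x i).
  by rewrite /X0 !mulmxA UU mul1mx -mulmxA UU mulmx1.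
pose Y s := U^T *m vsval (lfun_exp (s *: f) v) *m U.
pose dY s := U^T *m vsval (f (lfun_exp (s *: f) v)) *m U.
have dP t := @is_pderive_shift_det _ _ Y (dY t) t
  (fun i j => is_derive_lfun_exp f (sym_entry U i j) v t).
have Y0 : Y 0 = diag_mx (\row_i x i).
  by rewrite /Y (scale0r f) lfun_exp0 vE.
have vK : psd_relax R n k v.
  by apply/psd_relaxP; rewrite vE -(shift_det_conj _ UU) UX0 shift_det_diag.
have := coef_pderive_eq0 (k := k) dP; rewrite Y0 shift_det_diag.
rewrite trace_adj_diag => e.
have {}e : (\sum_i ((dY 0) i i)%:P * root_polyD1 x i)`_k = 0.
  apply: e => [t|t|t|//].
  - exact: char_poly_monic.
  - by rewrite size_char_poly; lia.
  - rewrite /Y shift_det_conj//; apply/psd_relaxP.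
    exact: (lie_Aut_coneP t hf vK).
rewrite -[RHS]e coef_sum; apply: eq_bigr => i _; rewrite coefCM.
congr (_ * _); rewrite /dY (scale0r f) lfun_exp0 -/(F X0) /X0 diag_decomp.
rewrite linear_sum mulmx_sumr mulmx_suml summxE; apply: eq_bigr => j _.
by rewrite linearZ/= -scalemxAr -scalemxAl !mxE mulrC.
Qed.

Let c := n%:R^-1 * \tr (F 1%:M).

(** The scalar is the same in all frames: the trace of the matrix of a frame
    is the trace of the image of the identity, because the off-diagonal
    entries vanish. *)
Lemma frame_mx_scalar U : U^T *m U = 1%:M -> frame_mx U = c%:M.
Proof.
move=> UU; have h := tangent_mx_scalar k0 kn (frame_mx_tangent UU).
rewrite h; congr (_ * _)%:M.
have -> : F 1%:M = \sum_j F (col j U *m (col j U)^T).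
  rewrite -linear_sum; congr F.
  have -> : 1%:M = U *m diag_mx (\row_i 1) *m U^T.
    rewrite (_ : \row__ _ = const_mx 1); last by apply/rowP => i; rewrite !mxE.
    by rewrite diag_const_mx mulmx1 (mulmx1C UU).
  by rewrite diag_decomp; apply: eq_bigr => j _; rewrite scale1r.
rewrite -[X in _ = \tr X]mulmx1 -(mulmx1C UU) mulmxA mxtrace_mulC mulmxA.
rewrite mulmx_sumr mulmx_suml /mxtrace; apply: eq_bigr => i _.
rewrite summxE (bigD1 i)//= big1 ?addr0 ?mxE// => j ji.
have /matrixP/(_ i j) := h; rewrite !mxE => ->.
by rewrite eq_sym (negPf ji).
Qed.

Let g := f - c *: \1%VF.

Let gE (Y : 'M[R]_n) : Y^T = Y -> lift_sym g Y = F Y - c *: Y.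
Proof.
move=> sY; rewrite /lift_sym /g add_lfunE opp_lfunE scale_lfunE id_lfunE.
by rewrite linearB; congr (_ - _); rewrite linearZ /= vsproj_sym.
Qed.

Let polar_gE x z : polar (lift_sym g) x x z z =
  2 * ((z^T *m F (x *m x^T) *m z) 0 0 - c * (dot z x * dot x z)).
Proof.
have sx : (x *m x^T)^T = x *m x^T by rewrite trmx_mul trmxK.
rewrite /polar -mulr2n linearMn /= gE// -scaler_nat.
rewrite -scalemxAr -scalemxAl mxE; congr (_ * _).
rewrite mulmxBr mulmxBl mxE [in X in _ + X]mxE; congr (_ - _).
have E : z^T *m (x *m x^T) *m z = (z^T *m x) *m (x^T *m z).
  by rewrite !mulmxA.
by rewrite -scalemxAr -scalemxAl mxE E !dotE -scalar_mxM mxE mulr1n.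
Qed.

Let frame_polar U i j : U^T *m U = 1%:M ->
  polar (lift_sym g) (col j U) (col j U) (col i U) (col i U) = 0.
Proof.
move=> UU; rewrite polar_gE.
have dU a b : dot (col a U) (col b U) = (a == b)%:R.
  have /matrixP/(_ a b) := UU; rewrite [RHS]mxE => <-.
  by rewrite /dot !mxE; apply: eq_bigr => l _; rewrite !mxE.
have -> : ((col i U)^T *m F (col j U *m (col j U)^T) *m col i U) 0 0 =
    frame_mx U i j.
  rewrite [RHS]mxE tr_col -row_mul [LHS]mxE [RHS]mxE.
  by apply: eq_bigr => l _; rewrite [row _ _ _ _]mxE [col _ _ _ _]mxE.
rewrite frame_mx_scalar// mxE !dU (eq_sym j) -natrM mulnb andbb mulr_natr.
by rewrite subrr mulr0.
Qed.

(** Any vector, and any two orthogonal vectors, are multiples of columns of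
    some orthogonal matrix, so the frames give the vanishing conditions for
    all vectors. *)
Lemma lie_psd_structure : exists A, A^T = - A /\
  forall X, vsval (f X) = c *: vsval X + (A *m vsval X - vsval X *m A).
Proof.
have sg : preserves_sym (lift_sym g) by move=> Y _; exact: vsval_sym.
pose i0 : 'I_n := Ordinal (ltn_trans (ltn0Sn _) kn).
pose i1 : 'I_n := Ordinal (leq_ltn_trans (ltn0Sn _) kn).
have i01 : i1 != i0 by [].
(* for x = 0 any unit vector will do, with coefficient r = 0 *)
have unit x : exists r, exists2 y : 'cV[R]_n, x = r *: y & dot y y = 1.
  have [->|x0] := eqVneq x 0.
    exists 0, (basis_vec R i0); first by rewrite scale0r.
    by rewrite dot_basis eqxx.
  have xx0 : 0 < dot x x.
    by rewrite lt_def dot_ge0 andbT; apply: contra_neq x0 => /dot_eq0.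
  have r0 : Num.sqrt (dot x x) != 0 by rewrite gt_eqF// sqrtr_gt0.
  exists (Num.sqrt (dot x x)), ((Num.sqrt (dot x x))^-1 *: x).
    by rewrite scalerA divff// scale1r.
  rewrite dotZ dotZr -{3}(sqr_sqrtr (ltW xx0)) expr2.
  by rewrite mulrA -invfM mulVf// mulf_neq0.
have hv : sq_vanishing (lift_sym g).
  split=> [x z|x].
    have [r [x' -> xx]] := unit x; have [s [z' -> zz]] := unit z.
    rewrite dotZ dotZr polar_scale => /eqP; rewrite !mulf_eq0.
    case/or3P=> [/eqP->|/eqP->|/eqP xz]; rewrite ?mul0r ?mulr0 ?mul0r//.
    have [U [UU <- <-]] := frame_exists i01 xx zz xz.
    by rewrite frame_polar// mulr0.
  have [r [x' -> xx]] := unit x; rewrite polar_scale.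
  have [U [UU <-]] := frame_exists1 i0 xx.
  by rewrite frame_polar// mulr0.
have [A [As AE]] := commutator_of_sq_vanishing sg hv.
exists A; split=> // X.
have : lift_sym g (vsval X) = A *m vsval X - vsval X *m A.
  exact: AE (vsval_sym X).
by rewrite gE ?vsval_sym// /lift_sym vsvalK => <-; rewrite addrC subrK.
Qed.

End LieElements.
End SymmetricCone.

(** * The Lie algebra of homotheties and infinitesimal rotations *)

Section Dimension.
Variables (R : realType) (n : nat).
Local Notation S := (subvs_of (sym_space R n)).

Definition lt_pair := {p : 'I_n * 'I_n | (p.1 < p.2)%N}.

(** Coordinates on the space of matrices B with B + B^T scalar: the common
    diagonal entry and the entries above the diagonal. *)
Definition co_coord := {ffun option lt_pair -> R^o}.

Definition co_mx (d : co_coord) : 'M[R]_n := \matrix_(i, j)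
  if insub (i, j) is Some p then d (Some p)
  else if insub (j, i) is Some p then - d (Some p) else d None.

Lemma co_mx_linear : linear co_mx.
Proof.
move=> a d d'; apply/matrixP => i j; rewrite !mxE.
case: insub => [p|]; first by rewrite !ffunE.
by case: insub => [p|]; rewrite !ffunE// /GRing.scale/= mulrN opprD.
Qed.

Lemma co_mx_lt (d : co_coord) (p : lt_pair) :
  co_mx d (val p).1 (val p).2 = d (Some p).
Proof. by rewrite mxE -surjective_pairing valK. Qed.

Lemma co_mx_tr (d : co_coord) : (co_mx d)^T = - co_mx d + (2 * d None)%:M.
Proof.
apply/matrixP => i j; rewrite !mxE.
case: (ltngtP i j) => [ij|ji|/val_inj ij]; last first.
- by rewrite ij !insubF/= ?ltnn// eqxx mulr1n; lra.
- rewrite (insubT (fun p : 'I_n * 'I_n => p.1 < p.2)%N (x := (j, i)) ji).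
  rewrite insubF/=; last by rewrite ltnNge ltnW.
  by rewrite opprK -val_eqE/= gtn_eqF// addr0.
- rewrite insubF/=; last by rewrite ltnNge ltnW.
  rewrite (insubT (fun p : 'I_n * 'I_n => p.1 < p.2)%N (x := (i, j)) ij).
  by rewrite -val_eqE/= ltn_eqF// addr0.
Qed.

Lemma co_mx_surj (a : R) (A : 'M[R]_n) : A^T = - A ->
  exists d, co_mx d = A + a%:M /\ d None = a.
Proof.
move=> sA; have sAE i j : A i j = - A j i.
  by have /matrixP/(_ j i) := sA; rewrite !mxE.
pose d : co_coord :=
  [ffun o => if o is Some p then A (val p).1 (val p).2 else a].
exists d; split; last by rewrite ffunE.
apply/matrixP => i j; rewrite !mxE.
case: (ltngtP i j) => [ij|ji|/val_inj ij]; last first.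
- rewrite ij !insubF/= ?ltnn// ffunE eqxx mulr1n.
  by have := sAE j j; lra.
- rewrite insubF/=; last by rewrite ltnNge ltnW.
  rewrite (insubT (fun p : 'I_n * 'I_n => p.1 < p.2)%N (x := (j, i)) ji).
  by rewrite ffunE/= -val_eqE/= gtn_eqF// addr0 -sAE.
- rewrite (insubT (fun p : 'I_n * 'I_n => p.1 < p.2)%N (x := (i, j)) ij).
  by rewrite ffunE/= -val_eqE/= ltn_eqF// addr0.
Qed.

(** X |-> B X + X B^T unites homotheties and commutators in one linear
    formula in B, since B^T = - B + 2 b for b the diagonal entry of B. *)
Definition co_act (d : co_coord) (X : S) : S := vsproj (sym_space R n)
  (co_mx d *m vsval X + vsval X *m (co_mx d)^T).

Lemma co_act_linear d : linear (co_act d).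
Proof.
move=> a X Y; rewrite /co_act -linearP; congr vsproj.
rewrite [vsval _]linearP/= mulmxDr mulmxDl -scalemxAr -scalemxAl.
by rewrite addrACA scalerDr.
Qed.

HB.instance Definition _ d := GRing.isLinear.Build R S S _
  (co_act d) (co_act_linear d).

Lemma co_actE d X : vsval (co_act d X) =
  (2 * d None) *: vsval X + (co_mx d *m vsval X - vsval X *m co_mx d).
Proof.
rewrite vsproj_sym; last first.
  by rewrite linearD/= !trmx_mul trmxK vsval_sym addrC.
rewrite co_mx_tr mulmxDr mulmxN mul_mx_scalar.
by rewrite [X in _ + X]addrC addrCA.
Qed.

Definition co_end (d : co_coord) : 'End(S) := linfun (co_act d).

Lemma co_end_linear : linear co_end.
Proof.
move=> a d d'; apply/lfunP => X; rewrite add_lfunE scale_lfunE !lfunE /=.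
rewrite /co_act -linearP; congr vsproj; rewrite co_mx_linear.
by rewrite linearP/= mulmxDr mulmxDl -scalemxAr -scalemxAl addrACA scalerDr.
Qed.

HB.instance Definition _ := GRing.isLinear.Build R co_coord 'End(S) _
  co_end co_end_linear.

(** Acting on the identity recovers the diagonal entry; acting on the j-th
    diagonal matrix unit then recovers column j. *)
Lemma co_end_inj : (0 < n)%N -> lker (linfun co_end) = 0%VS.
Proof.
move=> n0; apply/eqP; rewrite -subv0; apply/subvP => d.
rewrite memv_ker memv0 lfunE /= => /eqP d0.
have act0 (Y : 'M[R]_n) : Y^T = Y ->
    (2 * d None) *: Y + (co_mx d *m Y - Y *m co_mx d) = 0.
  move=> sY; have := co_actE d (vsproj _ Y); rewrite (vsproj_sym sY) => <-.
  have := lfunE (co_act d) (vsproj (sym_space R n) Y).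
  by rewrite -/(co_end d) d0 zero_lfunE /= => <-; rewrite linear0.
(* n > 0 provides an index at which the diagonal can be read off *)
have dN : d None = 0.
  pose i := Ordinal n0; have /matrixP/(_ i i) := act0 1%:M (trmx1 _ _).
  rewrite mulmx1 mul1mx subrr addr0 !mxE eqxx mulr1n mulr1 => /eqP.
  by rewrite mulf_eq0 pnatr_eq0 /= => /eqP.
apply/eqP/ffunP => -[p|]; rewrite [RHS]ffunE; last exact: dN.
rewrite -co_mx_lt; set i := (val p).1; set j := (val p).2.
have ij : (i == j) = false by rewrite -val_eqE ltn_eqF//; exact: (valP p).
have e1 : (co_mx d *m delta_mx j j) i j = co_mx d i j.
  rewrite mxE (bigD1 j)//= [delta_mx _ _ _ _]mxE !eqxx mulr1 big1 ?addr0//.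
  by move=> l /negPf lj; rewrite [delta_mx _ _ _ _]mxE lj mulr0.
have e2 : (delta_mx j j *m co_mx d) i j = 0.
  by rewrite mxE big1// => l _; rewrite [delta_mx _ _ _ _]mxE ij mul0r.
have /matrixP/(_ i j) := act0 (delta_mx j j) (trmx_delta _ _ _).
rewrite dN mulr0 scale0r add0r [LHS]mxE [X in _ + X]mxE e1 e2 subr0 => ->.
by rewrite mxE.
Qed.

Lemma card_lt_pair : #|{: lt_pair}| = 'C(n, 2).
Proof.
rewrite card_sig -sum1_card.
rewrite (eq_bigl (fun p : 'I_n * 'I_n => predT p.2 && (p.1 < p.2)%N)) //.
(* sum first over the larger index j: there are j choices for the smaller one *)
rewrite (reindex_inj (h := fun p : 'I_n * 'I_n => (p.2, p.1))) /=; last first.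
  by move=> [a b] [a' b'] /= [-> ->].
rewrite -(pair_big_dep predT (fun j i : 'I_n => (i < j)%N) (fun _ _ => 1%N)) /=.
rewrite -bin2_sum big_mkord; apply: eq_bigr => j _.
rewrite -(big_ord_widen n (fun=> 1%N)) ?(ltnW (ltn_ord j))//.
by rewrite sum1_card card_ord.
Qed.

Lemma dim_co_end : (0 < n)%N ->
  \dim (limg (linfun co_end)) = ((n ^ 2 - n + 2) %/ 2)%N.
Proof.
move=> n0; rewrite limg_dim_eq ?co_end_inj ?capv0// dimvf.
have -> : dim co_coord = (#|{: option lt_pair}| * 1)%N by [].
rewrite card_option card_lt_pair muln1 bin2.
have e : (n ^ 2 - n = n * n.-1)%N.
  by rewrite -mulnn -[X in (_ - X)%N]muln1 -mulnBr subn1.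
rewrite e addn2 -divn2; lia.
Qed.

End Dimension.

Lemma lie_psd (R : realType) (n k : nat) : (0 < k)%N -> (k.+3 <= n)%N ->
  [set` limg (linfun (@co_end R n))] = lie_Aut_cone (psd_relax R n k).
Proof.
move=> k0 kn; apply/seteqP; split=> f /=.
  move=> /memv_imgP[d _ ->]; rewrite lfunE /=.
  apply: (@lie_psd_commutator _ _ _ _ (2 * d None) (co_mx d)) => X.
  by rewrite lfunE /= co_actE.
move=> hf; have [A [sA fE]] := lie_psd_structure hf k0 kn.
set c := _^-1 * _ in fE.
have [d [dE dN]] := co_mx_surj (2^-1 * c) sA.
apply/memv_imgP; exists d; first exact: memvf.
rewrite lfunE /=; apply/lfunP => X; rewrite lfunE /=.
apply/val_inj; rewrite /= -/(vsval (f X)) -/(vsval (co_act d X)).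
rewrite fE co_actE dE dN mulrA divff// mul1r; congr (_ + _).
by rewrite mulmxDl mulmxDr scalar_mxC opprD addrACA subrr addr0.
Qed.

Theorem corollary4p8 (R : realType) (n k : nat)
    (hn : (4 <= n)%N) (hk : (1 <= k <= n - 3)%N) :
  lyapunov_rank (orthant_relax R n k) = 1%N /\
  lyapunov_rank (psd_relax R n k) = ((n ^ 2 - n + 2) %/ 2)%N.
Proof.
have [k0 kn] : (0 < k)%N /\ (k.+3 <= n)%N by lia.
split.
  rewrite (lyapunov_rank_dim (lie_orthant R k0 kn)) dim_vline.
  have : (\1%VF : 'End('cV[R]_n)) != 0.
    apply/eqP => /lfunP/(_ (const_mx 1)); rewrite id_lfunE zero_lfunE.
    have n0 : (0 < n)%N by lia.
    move=> /matrixP/(_ (Ordinal n0) 0) /eqP.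
    by rewrite !mxE oner_eq0.
  by move=> ->.
by rewrite (lyapunov_rank_dim (lie_psd R k0 kn)) dim_co_end//; lia.
Qed.
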